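(* Let $p\in(1,\infty)$ and let $\mathcal{J}_p(\omega_1)$ be taken over the complex field. Then $K_0(\mathscr{B}(\mathcal{J}_p(\omega_1)))\cong\mathbb{Z}$.
   Context: For $x\colon[0,\omega_1)\to\mathbb{C}$ put $\|x\|_{p,0}=\sup\big(\sum_{j=1}^n|x(\alpha_j)-x(\alpha_{j-1})|^p\big)^{1/p}$, the supremum over $n\in\mathbb{N}$ and $0\leqslant\alpha_0<\dots<\alpha_n<\omega_1$. The long James space $\mathcal{J}_p(\omega_1)$ is the Banach space (under $\|\cdot\|_{p,0}$ or an equivalent norm) of continuous functions $x\colon[0,\omega_1)\to\mathbb{C}$ with $\lim_{\alpha\to\omega_1}x(\alpha)=0$ and $\|x\|_{p,0}<\infty$. $\mathscr{B}(\mathcal{J}_p(\omega_1))$ is the Banach algebra of bounded operators on it, and $K_0$ is the usual $K_0$-group of a unital complex Banach algebra (the Grothendieck group of the semigroup of equivalence classes of idempotent matrices over the algebra); the isomorphism is of abelian groups. *)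

(* Defs.v *)
From HB Require Import structures.
From mathcomp Require Import all_boot ssrAC all_order all_algebra generic_quotient.
From mathcomp Require Import complex ring.
From mathcomp Require Import all_classical all_reals all_analysis wochoice.

Set Implicit Arguments.
Unset Strict Implicit.
Unset Printing Implicit Defensive.

Import Order.TTheory GRing.Theory Num.Theory.
Import numFieldNormedType.Exports ComplexField.Normc.

Local Open Scope classical_set_scope.
Local Open Scope ring_scope.
Local Open Scope quotient_scope.

(* The Grothendieck group of a commutative monoid: the class of (a, b) stands
   for the formal difference a - b. *)
Section Grothendieck.
Variable M : nmodType.

Definition groth_rel : rel (M * M) :=
  fun u v => `[< exists k, u.1 + v.2 + k = v.1 + u.2 + k >].

Fact groth_rel_refl : reflexive groth_rel.
Proof. by move=> u; apply/asboolP; exists 0. Qed.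

Fact groth_rel_sym : symmetric groth_rel.
Proof. by move=> u v; apply/asboolP/asboolP => -[k kP]; exists k. Qed.

Fact groth_rel_trans : transitive groth_rel.
Proof.
move=> v u w /asboolP[k kP] /asboolP[l lP]; apply/asboolP.
exists (v.1 + v.2 + k + l); rewrite !addrA.
rewrite [LHS](ACl (1*4*5*3*2*6))/= kP [LHS](ACl (4*5*6*1*2*3))/= lP.
by rewrite [LHS](ACl (1*5*4*2*6*3)).
Qed.

Canonical groth_equiv :=
  EquivRel groth_rel groth_rel_refl groth_rel_sym groth_rel_trans.

Definition groth : Type := {eq_quot groth_equiv}.
HB.instance Definition _ := Choice.on groth.
HB.instance Definition _ := EqQuotient.on groth.

Definition groth_add (x y : groth) : groth := \pi_groth (repr x + repr y).
Definition groth_opp (x : groth) : groth := \pi_groth ((repr x).2, (repr x).1).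

Lemma groth_repr (u : M * M) : groth_rel (repr (\pi_groth u)) u.
Proof. by apply/(@eqquotP _ _ groth); rewrite reprK. Qed.

Lemma pi_groth_add u v : groth_add (\pi_groth u) (\pi_groth v) = \pi_groth (u + v).
Proof.
apply/eqquotP/asboolP.
have /asboolP[k kP] := groth_repr u; have /asboolP[l lP] := groth_repr v.
exists (k + l); rewrite /= !addrA.
rewrite [LHS](ACl (1*3*5*2*4*6))/= kP [LHS](ACl (4*5*6*1*2*3))/= lP.
by rewrite [LHS](ACl (4*1*5*2*6*3)).
Qed.

Lemma pi_groth_opp u : groth_opp (\pi_groth u) = \pi_groth (u.2, u.1).
Proof.
apply/eqquotP/asboolP; have /asboolP[k kP] := groth_repr u.
by exists k; rewrite /= [_ + u.1]addrC -kP [u.2 + _]addrC.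
Qed.

Fact groth_addA : associative groth_add.
Proof.
elim/quotW=> u y z; elim/quotW: y => v; elim/quotW: z => w; 
by rewrite (pi_groth_add v w) (pi_groth_add u v) (pi_groth_add u (v + w)) (pi_groth_add (u + v) w) addrA.
Qed.
Fact groth_addC : commutative groth_add.
Proof. by elim/quotW=> u y; elim/quotW: y => v; rewrite !pi_groth_add addrC. Qed.
Fact groth_add0 : left_id (\pi_groth 0) groth_add.
Proof. by elim/quotW=> u; rewrite pi_groth_add add0r. Qed.
Fact groth_addN : left_inverse (\pi_groth 0) groth_opp groth_add.
Proof.
elim/quotW=> u; rewrite pi_groth_opp pi_groth_add.
by apply/eqquotP/asboolP; exists 0; rewrite /= !addr0 add0r addrC.
Qed.

HB.instance Definition _ :=
  GRing.isZmodule.Build groth groth_addA groth_addC groth_add0 groth_addN.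
End Grothendieck.

(* K_0 in its algebraic form, which for a Banach algebra uses only the
   underlying ring: idempotents e and f, possibly of different sizes, are
   equivalent when e = xy and f = yx for rectangular matrices x and y, and
   classes are added by forming block diagonal sums. *)
Section IdempotentMatrices.
Variable A : pzRingType.

Record idem := Idem {
  idem_dim : nat;
  idem_mx : 'M[A]_idem_dim;
  idem_mxK : idem_mx *m idem_mx = idem_mx }.

HB.instance Definition _ := gen_eqMixin idem.
HB.instance Definition _ := gen_choiceMixin idem.

Definition idem_rel : rel idem := fun e f => `[< exists
  (x : 'M[A]_(idem_dim e, idem_dim f)) (y : 'M[A]_(idem_dim f, idem_dim e)),
  x *m y = idem_mx e /\ y *m x = idem_mx f >].

Fact idem_rel_refl : reflexive idem_rel.
Proof.
by move=> e; apply/asboolP; exists (idem_mx e), (idem_mx e); rewrite idem_mxK.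
Qed.

Fact idem_rel_sym : symmetric idem_rel.
Proof. by move=> e f; apply/asboolP/asboolP => -[x [y []]]; exists y, x. Qed.

Fact idem_rel_trans : transitive idem_rel.
Proof.
move=> f e g /asboolP[x [y [xy yx]]] /asboolP[z [w [zw wz]]].
apply/asboolP; exists (x *m z), (w *m y); split.
  by rewrite mulmxA -(mulmxA x) zw -yx -mulmxA -mulmxA xy mulmxA xy idem_mxK.
by rewrite mulmxA -(mulmxA w) yx -zw -mulmxA -mulmxA wz mulmxA wz idem_mxK.
Qed.

Canonical idem_equiv :=
  EquivRel idem_rel idem_rel_refl idem_rel_sym idem_rel_trans.

Definition idem_class : Type := {eq_quot idem_equiv}.
HB.instance Definition _ := Choice.on idem_class.
HB.instance Definition _ := EqQuotient.on idem_class.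

Fact idem0_subproof : (0 : 'M[A]_0) *m (0 : 'M[A]_0) = 0.
Proof. exact: mul0mx. Qed.
Definition idem0 : idem := @Idem 0 0 idem0_subproof.

Fact idem_sum_subproof (e f : idem) :
  let s := block_mx (idem_mx e) 0 0 (idem_mx f) in s *m s = s.
Proof.
by rewrite /= mulmx_block !(mulmx0, mul0mx) !(addr0, add0r) !idem_mxK.
Qed.
Definition idem_sum (e f : idem) : idem := Idem (idem_sum_subproof e f).

Definition idem_class_add (a b : idem_class) : idem_class :=
  \pi_idem_class (idem_sum (repr a) (repr b)).

Lemma idem_repr (e : idem) : idem_rel (repr (\pi_idem_class e)) e.
Proof. by apply/(@eqquotP _ _ idem_class); rewrite reprK. Qed.

Lemma pi_idem_add e f :
  idem_class_add (\pi_idem_class e) (\pi_idem_class f) = \pi_idem_class (idem_sum e f).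
Proof.
apply/eqquotP/asboolP => /=.
have /asboolP[x [y [xy yx]]] := idem_repr e.
have /asboolP[z [w [zw wz]]] := idem_repr f.
exists (block_mx x 0 0 z), (block_mx y 0 0 w).
by rewrite !mulmx_block !(mulmx0, mul0mx) !(addr0, add0r) xy yx zw wz.
Qed.

Lemma idem_rel_cast n n' (eqn : n = n') (x : 'M[A]_n) (x' : 'M[A]_n') xx xx' :
  x' = castmx (eqn, eqn) x -> idem_rel (@Idem n x xx) (@Idem n' x' xx').
Proof.
case: _ / eqn x' xx' => x' xx'; rewrite castmx_id => ?; subst x'.
by apply/asboolP; exists x, x.
Qed.

Fact idem_class_addA : associative idem_class_add.
Proof.
elim/quotW=> e y z; elim/quotW: y => f; elim/quotW: z => g.
rewrite (pi_idem_add f g) (pi_idem_add e f) !pi_idem_add.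
symmetry; apply/eqquotP.
apply: (@idem_rel_cast _ _ (esym (addnA _ _ _))) => /=.
have := @block_mxA _ _ _ _ _ _ _ (idem_mx e) 0 0 0 (idem_mx f) 0 0 0 (idem_mx g).
by rewrite /= !row_mx0 !col_mx0.
Qed.

Fact idem_class_addC : commutative idem_class_add.
Proof.
elim/quotW=> e y; elim/quotW: y => f; rewrite !pi_idem_add.
apply/eqquotP/asboolP => /=.
exists (block_mx 0 (idem_mx e) (idem_mx f) 0).
exists (block_mx 0 (idem_mx f) (idem_mx e) 0).
by rewrite !mulmx_block !(mulmx0, mul0mx) !(addr0, add0r) !idem_mxK.
Qed.

Fact idem_class_add0 : left_id (\pi_idem_class idem0) idem_class_add.
Proof.
elim/quotW=> e; rewrite pi_idem_add; apply/eqquotP/asboolP => /=.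
exists (col_mx 0 (idem_mx e)), (row_mx 0 (idem_mx e)).
by rewrite mul_col_row mul_row_col !(mulmx0, mul0mx) !(addr0, add0r) idem_mxK.
Qed.

HB.instance Definition _ := GRing.isNmodule.Build idem_class
  idem_class_addA idem_class_addC idem_class_add0.

Definition K0 := groth idem_class.
HB.instance Definition _ := GRing.Zmodule.on K0.
End IdempotentMatrices.

Local Close Scope quotient_scope.

Section BoundedOperators.
Context {K : numFieldType} (V : normedModType K).

Definition bounded_linear : {pred V -> V} :=
  [pred T | `[< linear T /\ exists M, forall x, `|T x| <= M * `|x| >]].

Fact bounded_linear_zmod_closed : zmod_closed bounded_linear.
Proof.
split=> [|S T]; rewrite !inE.
  split; first by move=> a x y; rewrite /= scaler0 addr0.
  by exists 0 => x; rewrite mul0r normr0.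
move=> [Slin [M SM]] [Tlin [N TN]]; split=> [a x y|].
  have E f g z : (f - g : V -> V) z = f z - g z by [].
  by rewrite !E Slin Tlin scalerBr opprD addrACA.
exists (M + N) => x; rewrite mulrDl.
by apply: le_trans (ler_normB _ _) _; rewrite lerD.
Qed.
HB.instance Definition _ :=
  GRing.isZmodClosed.Build (V -> V) bounded_linear bounded_linear_zmod_closed.

Definition bounded_op : Type := {T : V -> V | T \in bounded_linear}.
HB.instance Definition _ := [isSub of bounded_op for @sval _ _].
HB.instance Definition _ := [Choice of bounded_op by <:].
HB.instance Definition _ := [SubChoice_isSubZmodule of bounded_op by <:].

Fact bounded_op_id_subproof : idfun \in bounded_linear.
Proof. by rewrite inE; split=> //; exists 1 => x; rewrite mul1r. Qed.
Definition bounded_op_id : bounded_op := Sub idfun bounded_op_id_subproof.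

Fact bounded_op_comp_subproof (S T : bounded_op) : val S \o val T \in bounded_linear.
Proof.
have:= valP S; have:= valP T; rewrite !inE.
move=> [Tlin [N TN]] [Slin [M SM]]; split=> [a x y|].
  by rewrite /= Tlin Slin.
exists (`|M| * N) => x; apply: le_trans (SM _) _.
rewrite -mulrA; apply: le_trans (_ : `|M| * `|val T x| <= _).
  have [->|Tx0] := eqVneq (val T x) 0; first by rewrite normr0 !mulr0.
  have Tx_gt0 : 0 < `|val T x| by rewrite normr_gt0.
  rewrite ler_pM2r// real_ler_norm// ger0_real//.
  by rewrite -(pmulr_lge0 _ Tx_gt0); apply: le_trans (SM _).
by rewrite ler_wpM2l.
Qed.
Definition bounded_op_comp (S T : bounded_op) : bounded_op := Sub (val S \o val T) (bounded_op_comp_subproof S T).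

Fact bounded_op_compA : associative bounded_op_comp.
Proof. by move=> S T U; apply: val_inj. Qed.
Fact bounded_op_comp1l : left_id bounded_op_id bounded_op_comp.
Proof. by move=> T; apply: val_inj. Qed.
Fact bounded_op_comp1r : right_id bounded_op_id bounded_op_comp.
Proof. by move=> T; apply: val_inj. Qed.
Fact bounded_op_compDl : left_distributive bounded_op_comp +%R.
Proof. by move=> S T U; apply: val_inj. Qed.
Fact bounded_op_compDr : right_distributive bounded_op_comp +%R.
Proof.
move=> S T U; apply: val_inj; apply/funext => x /=.
have := valP S; rewrite inE => -[Slin _].
by have := Slin 1 (val T x) (val U x); rewrite !scale1r.
Qed.
HB.instance Definition _ := GRing.Zmodule_isPzRing.Build bounded_op
  bounded_op_compA bounded_op_comp1l bounded_op_comp1r bounded_op_compDl bounded_op_compDr.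

End BoundedOperators.

Lemma minkowski_sum (R : realType) (p : R) (n : nat) (a b : 'I_n -> R) :
  1 < p -> (forall i, 0 <= a i) -> (forall i, 0 <= b i) ->
  (\sum_(i < n) (a i + b i) `^ p) `^ p^-1 <=
  (\sum_(i < n) a i `^ p) `^ p^-1 + (\sum_(i < n) b i `^ p) `^ p^-1.
Proof.
move=> p1 a0 b0; have p0 : 0 < p by exact: lt_trans p1.
have sum_ge0 (c : 'I_n -> R) : 0 <= \sum_(i < n) c i `^ p.
  by apply: sumr_ge0 => i _; exact: powR_ge0.
have powK (c : 'I_n -> R) :
    ((\sum_(i < n) c i `^ p) `^ p^-1) `^ p = \sum_(i < n) c i `^ p.
  by rewrite -powRrM mulVf ?gt_eqF// powRr1.
have eq0P (c : 'I_n -> R) : (forall i, 0 <= c i) ->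
    (\sum_(i < n) c i `^ p) `^ p^-1 = 0 -> forall i, c i = 0.
  move=> c0 /eqP; rewrite powR_eq0 => /andP[/eqP s0 _] i.
  move/eqP: s0; rewrite psumr_eq0; last by move=> j _; exact: powR_ge0.
  by move=> /allP/(_ i (mem_index_enum _)) /=; rewrite powR_eq0 => /andP[/eqP].
have powK_a := powK a; have powK_b := powK b.
set A := (\sum_(i < n) a i `^ p) `^ p^-1 in powK_a *.
set B := (\sum_(i < n) b i `^ p) `^ p^-1 in powK_b *.
have [A0|A0] := eqVneq A 0.
  by rewrite A0 add0r; under eq_bigr do rewrite (eq0P _ a0 A0) add0r.
have [B0|B0] := eqVneq B 0.
  by rewrite B0 addr0; under eq_bigr do rewrite (eq0P _ b0 B0) addr0.
have {A0}Agt0 : 0 < A by rewrite lt_neqAle eq_sym A0 powR_ge0.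
have {B0}Bgt0 : 0 < B by rewrite lt_neqAle eq_sym B0 powR_ge0.
clearbody A B.
have ABgt0 : 0 < A + B by exact: addr_gt0.
have -> : A + B = ((A + B) `^ p) `^ p^-1.
  by rewrite -powRrM mulfV ?gt_eqF// powRr1// ltW.
apply: ge0_ler_powR; rewrite ?nnegrE ?invr_ge0 ?powR_ge0 ?(ltW p0)//.
pose t := A / (A + B).
have t0 : 0 <= t by rewrite divr_ge0// ltW.
have t1 : t <= 1 by rewrite ler_pdivrMr// mul1r lerDl ltW.
have tE : 1 - t = B / (A + B).
  by rewrite /t -(divff (lt0r_neq0 ABgt0)) -mulrBl [A + B]addrC addrK.
apply: (@le_trans _ _ (\sum_(i < n)
   (A + B) `^ p * (t * (a i / A) `^ p + (1 - t) * (b i / B) `^ p))).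
  apply: ler_sum => i _.
  have -> : a i + b i = (A + B) * (t * (a i / A) + (1 - t) * (b i / B)).
    rewrite tE /t; field.
    by rewrite !gt_eqF.
  rewrite powRM ?(ltW ABgt0)//; last first.
    by rewrite addr_ge0// mulr_ge0// ?subr_ge0// divr_ge0// ltW.
  rewrite ler_wpM2l ?powR_ge0//.
  apply: (convex_powR (ltW p1) (Itv01 t0 t1)) => /=;
    by rewrite inE/= in_itv/= andbT divr_ge0// ltW.
rewrite -mulr_sumr big_split/= -!mulr_sumr.
have norm1 (c : 'I_n -> R) (C : R) : (forall i, 0 <= c i) -> 0 < C ->
    C `^ p = \sum_(i < n) c i `^ p -> \sum_(i < n) (c i / C) `^ p = 1.
  move=> c0 C0 CE.
  under eq_bigr do rewrite powRM ?invr_ge0 ?(ltW C0)//.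
  rewrite -mulr_suml -CE -powRM ?invr_ge0 ?(ltW C0)// divff ?gt_eqF//.
  by rewrite powR1.
by rewrite !norm1// !mulr1 addrC subrK mulr1.
Qed.

(* A chain satisfies [is_omega1] exactly when it is order isomorphic to the set
   of countable ordinals; [omega1_exists] below shows that there is one. *)
Definition is_omega1 {d} (W : orderType d) : Prop :=
  [/\ well_order (<=%O : rel W), ~ countable [set: W] &
      forall a : W, countable [set b | (b < a)%O]].

Lemma is_omega1_nonempty {d} (W : orderType d) : is_omega1 W -> inhabited W.
Proof.
case=> _ Wunc _; apply: contrapT => W0; apply: Wunc.
rewrite (_ : [set: W] = set0)//; apply/seteqP; split=> // a _.
by apply: W0; exists.
Qed.

Section Omega1Exists.

Definition bits : Type := nat -> bool.
HB.instance Definition _ := gen_eqMixin bits.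
HB.instance Definition _ := gen_choiceMixin bits.

Definition bits_le : rel bits := sval (well_ordering_principle bits).

Fact bits_wo : well_order bits_le.
Proof. exact: (svalP (well_ordering_principle bits)). Qed.

Let wo : wo_chain bits_le predT.
Proof. by move=> A _; exact: bits_wo. Qed.

Fact bits_le_refl : reflexive bits_le.
Proof. by move=> a; apply: (wo_chain_reflexive wo). Qed.

Fact bits_le_anti : antisymmetric bits_le.
Proof. by move=> a b; apply: (wo_chain_antisymmetric wo). Qed.

Fact bits_le_total : total bits_le.
Proof. by move=> a b; apply: (wo_chainW wo). Qed.

Fact bits_le_trans : transitive bits_le.
Proof.
move=> b a c ab bc.
have [|z [[zabc zmin] _]] := bits_wo (A := [pred s | [|| s == a, s == b | s == c]]).
  by exists a; rewrite inE eqxx.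
move: zabc; rewrite inE => /or3P[] /eqP zE; subst z.
- by apply: zmin; rewrite inE eqxx !orbT.
- have ba : bits_le b a by apply: zmin; rewrite inE eqxx.
  by rewrite (bits_le_anti (x := a) (y := b)) ?ab.
- have cb : bits_le c b by apply: zmin; rewrite inE eqxx orbT.
  by rewrite (bits_le_anti (x := c) (y := b)) ?cb.
Qed.

HB.instance Definition _ := Order.Le_isPOrder.Build Order.default_display bits
  bits_le_refl bits_le_anti bits_le_trans.
HB.instance Definition _ := Order.POrder_isTotal.Build _ bits bits_le_total.

Definition in_omega1 : {pred bits} :=
  [pred a | `[< countable [set b : bits | (b <= a)%O] >]].

Definition omega1 : Type := {a : bits | a \in in_omega1}.
HB.instance Definition _ := [isSub of omega1 for @sval _ _].
HB.instance Definition _ := [Choice of omega1 by <:].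
HB.instance Definition _ := [SubChoice_isSubOrder of omega1 by <: with Order.default_display].

Fact bits_uncountable : ~ countable [set: bits].
Proof.
move=> /countable_injP[f finj].
pose g : bits := fun n => `[< exists2 h : bits, f h = n & h n = false >].
have fN (h : bits) : f h = f g -> h = g by apply: finj; rewrite inE.
have [gg|/negbTE ng] := boolP (g (f g)); last first.
  have : g (f g) by apply/asboolP; exists g.
  by rewrite ng.
have /asboolP[h /fN hg h0] := gg.
by rewrite hg gg in h0.
Qed.

Lemma omega1P : is_omega1 omega1.
Proof.
split.
- apply: antisymmetric_well_order; first exact: le_anti.
  move=> A [a aA].
  pose B : {pred bits} := [pred b | `[< exists2 c : omega1, c \in A & val c = b >]].
  have [|z [[zB zmin] _]] := bits_wo (A := B).
    by exists (val a); apply/asboolP; exists a.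
  move/asboolP: zB => [c cA cz]; exists c; split=> // b bA.
  rewrite -[(c <= b)%O]/(bits_le (val c) (val b)) cz.
  by apply: zmin; apply/asboolP; exists b.
- move=> cW.
  have cO : countable [set` in_omega1].
    rewrite (_ : [set` in_omega1] = [set val a | a in [set: omega1]]).
      by apply: sub_countable cW; exact: card_image_le.
    apply/seteqP; split=> [a aO|_ [a _ <-]]; last exact: (valP a).
    by exists (Sub a aO).
  have [|z [[zN zmin] _]] := bits_wo (A := [predC in_omega1]).
    apply: contrapT => noC; apply: bits_uncountable.
    rewrite (_ : [set: bits] = [set` in_omega1])//; apply/seteqP; split=> // a _.
    by apply: contrapT => aN; apply: noC; exists a; exact/negP.
  move/negP: zN; apply; apply/asboolP.
  move/countable_injP: cO => [f finj].
  apply/countable_injP; exists (fun b => if b == z then 0%N else (f b).+1).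
  have ltO b : (b <= z)%O -> b != z -> b \in [set` in_omega1].
    move=> bz bNz; rewrite inE /=; apply: contrapT => bN.
    have zb : bits_le z b by apply: zmin; exact/negP.
    by move/eqP: bNz; apply; apply: bits_le_anti; apply/andP.
  move=> b c; rewrite !inE /= => bz cz.
  have [->|bNz] := eqVneq b z; have [->|cNz] := eqVneq c z => //.
  by move=> [fbc]; apply: finj => //; exact: ltO.
- move=> a; have /asboolP/countable_injP[f finj] := valP a.
  apply/countable_injP; exists (f \o val) => b c.
  rewrite !inE => /ltW ba /ltW ca fbc; apply: val_inj.
  by apply: finj; rewrite ?inE.
Qed.
End Omega1Exists.
Lemma omega1_exists : exists (d : Order.disp_t) (W : orderTopologicalType d), is_omega1 W.
Proof. by exists _, (order_topology omega1); exact: omega1P. Qed.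

Section LongJamesSpace.
Context {R : realType} {d : Order.disp_t} {W : orderTopologicalType d}.
Local Open Scope complex_scope.

(* The filter of neighbourhoods of omega_1, traced on [0, omega_1[. *)
Definition tails : set_system W :=
  filter_from [set: W] (fun a => [set b | (a <= b)%O]).

(* Only a 0, ..., a n matter; n = 0 contributes the value 0. *)
Definition variation (p : R) (x : W -> R[i]^o) (n : nat) (a : nat -> W) : R :=
  (\sum_(i < n) normc (x (a i.+1) - x (a i)) `^ p) `^ p^-1.

Definition variations (p : R) (x : W -> R[i]^o) : set R :=
  [set r | exists (n : nat) (a : nat -> W),
    (forall i, (i < n)%N -> (a i < a i.+1)%O) /\ r = variation p x n a].

(* [sup] is only meaningful on functions whose set of variations is bounded,
   which is part of membership in the long James space. *)
Definition james_norm (p : R) (x : W -> R[i]^o) : R := sup (variations p x).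

(* The two proofs are not used to define the set, but they are needed for it to
   be a normed space (Minkowski's inequality, properness of [tails]), so that
   the canonical structures below are attached to a type mentioning them. *)
Definition in_james (p : R) of 1 < p & is_omega1 W : {pred W -> R[i]^o} :=
  [pred x | `[< [/\ continuous x, x @ tails --> (0 : R[i]^o)
                  & has_ubound (variations p x)] >]].

Context {p : R} (p1 : 1 < p) (hW : is_omega1 W).

Fact tails_filter : ProperFilter tails.
Proof.
have [a0] := is_omega1_nonempty hW.
apply: filter_from_proper; last by move=> a _; exists a => /=.
apply: filter_from_filter; first by exists a0.
move=> a b _ _; exists (Order.max a b) => // c /=.
by rewrite ge_max => /andP.
Qed.

Lemma variationD x y n a :
  variation p (x + y) n a <= variation p x n a + variation p y n a.
Proof.
have p0 : 0 < p by exact: lt_trans p1.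
have ge0_sum (z : 'I_n -> R) : 0 <= \sum_(i < n) z i `^ p.
  by apply: sumr_ge0 => i _; exact: powR_ge0.
have normc_ge0 (z : R[i]) : 0 <= normc z by case: z => u v; exact: sqrtr_ge0.
apply: (le_trans _ (minkowski_sum p1 (fun i => normc_ge0 _) (fun i => normc_ge0 _))).
apply: ge0_ler_powR; rewrite ?nnegrE ?invr_ge0 ?(ltW p0)//.
apply: ler_sum => i _; apply: ge0_ler_powR; rewrite ?nnegrE ?(ltW p0)//.
  exact: addr_ge0.
apply: le_trans (le_normcD _ _).
by rewrite le_eqVlt; apply/orP; left; apply/eqP; congr normc; rewrite opprD addrACA.
Qed.

Lemma variationZ (c : R[i]) x n a :
  variation p (c *: x) n a = normc c * variation p x n a.
Proof.
have p0 : 0 < p by exact: lt_trans p1.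
have normc_ge0 (z : R[i]) : 0 <= normc z by case: z => u v; exact: sqrtr_ge0.
rewrite /variation.
have -> : \sum_(i < n) normc ((c *: x) (a i.+1) - (c *: x) (a i)) `^ p =
    normc c `^ p * \sum_(i < n) normc (x (a i.+1) - x (a i)) `^ p.
  rewrite mulr_sumr; apply: eq_bigr => i _.
  by rewrite -powRM// -normcM mulrBr.
rewrite powRM ?powR_ge0//; last by apply: sumr_ge0 => i _; exact: powR_ge0.
by rewrite -powRrM mulfV ?gt_eqF// powRr1.
Qed.

Lemma in_jamesP (x : W -> R[i]^o) : x \in in_james p1 hW <->
  [/\ continuous x, x @ tails --> (0 : R[i]^o) & has_ubound (variations p x)].
Proof. by split=> [/asboolP//|xJ]; exact/asboolP. Qed.

Fact in_james_submod_closed : submod_closed (in_james p1 hW).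
Proof.
have F := tails_filter.
have normc_ge0 (z : R[i]) : 0 <= normc z by case: z => u v; exact: sqrtr_ge0.
split.
  apply/in_jamesP; split.
  - exact: cst_continuous.
  - exact: cvg_cst.
  - exists 0 => _ [n [a [_ ->]]].
    by rewrite -(scale0r 0) variationZ /normc /= expr0n addr0 sqrtr0 mul0r.
move=> c x y /in_jamesP[xc x0 [M xM]] /in_jamesP[yc y0 [N yN]].
apply/in_jamesP; split.
- by move=> t; apply: cvgD; [apply: cvgZr; exact: xc|exact: yc].
- have := cvgD (cvgZr (k := c) x0) y0.
  rewrite scaler0 addr0; apply.
- exists (normc c * M + N) => _ [n [a [an ->]]].
  apply: le_trans (variationD _ _ _ _) _.
  rewrite variationZ lerD//; last by apply: yN; exists n, a.
  by rewrite ler_wpM2l//; apply: xM; exists n, a.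
Qed.
HB.instance Definition _ := GRing.isSubmodClosed.Build _ _ (in_james p1 hW)
  in_james_submod_closed.

Definition james : Type := {x : W -> R[i]^o | x \in in_james p1 hW}.
HB.instance Definition _ := [isSub of james for @sval _ _].
HB.instance Definition _ := [Choice of james by <:].
HB.instance Definition _ := [SubChoice_isSubZmodule of james by <:].
HB.instance Definition _ := [SubZmodule_isSubLmodule of james by <:].

Lemma variations_has_sup (x : james) : has_sup (variations p (val x)).
Proof.
have /in_jamesP := valP x => -[_ _ xub]; split=> //.
have [a0] := is_omega1_nonempty hW.
by exists (variation p (val x) 0 (fun=> a0)), 0%N, (fun=> a0).
Qed.

Lemma variation_le_norm (x : james) n a :
  (forall i, (i < n)%N -> (a i < a i.+1)%O) ->
  variation p (val x) n a <= james_norm p (val x).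
Proof.
move=> an; apply: ub_le_sup; first by have [] := variations_has_sup x.
by exists n, a.
Qed.

Lemma james_norm_le (x : james) M :
  (forall n a, (forall i, (i < n)%N -> (a i < a i.+1)%O) ->
    variation p (val x) n a <= M) -> james_norm p (val x) <= M.
Proof.
move=> xM; apply: ge_sup; first by have [] := variations_has_sup x.
by move=> _ [n [a [an ->]]]; exact: xM.
Qed.

Fact james_normD (x y : james) :
  (james_norm p (val (x + y)))%:C
  <= (james_norm p (val x))%:C + (james_norm p (val y))%:C.
Proof.
rewrite -rmorphD lecR; apply: james_norm_le => n a an.
by apply: le_trans (variationD _ _ _ _) _; rewrite lerD// variation_le_norm.
Qed.

Fact james_normZ (c : R[i]) (x : james) :
  (james_norm p (val (c *: x)))%:C = `|c| * (james_norm p (val x))%:C.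
Proof.
have normc_ge0 (z : R[i]) : 0 <= normc z by case: z => u v; exact: sqrtr_ge0.
have le b (y : james) : james_norm p (val (b *: y)) <= normc b * james_norm p (val y).
  apply: james_norm_le => n a an; rewrite variationZ ler_wpM2l//.
  exact: variation_le_norm.
have -> : `|c| = (normc c)%:C by [].
rewrite -rmorphM; congr (_%:C); apply/eqP; rewrite eq_le le/=.
have [->|c0] := eqVneq c 0.
  rewrite /normc /= expr0n addr0 sqrtr0 mul0r.
  have [a0] := is_omega1_nonempty hW.
  apply: (@le_trans _ _ (variation p (val (0 *: x)) 0 (fun=> a0))).
    exact: powR_ge0.
  exact: variation_le_norm.
have := le c^-1 (c *: x); rewrite scalerA mulVf// scale1r normcV.
by rewrite ler_pdivlMl// lt_neqAle normc_ge0 eq_sym andbT; apply: contra_neq c0 => /eq0_normc.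
Qed.

Fact james_norm_eq0 (x : james) : (james_norm p (val x))%:C = 0 -> x = 0.
Proof.
move=> /complexI x0; apply: val_inj; apply/funext => a /=.
have p0 : 0 < p by exact: lt_trans p1.
have normc_ge0 (z : R[i]) : 0 <= normc z by case: z => u v; exact: sqrtr_ge0.
have xE b c : (b < c)%O -> val x c = val x b.
  move=> bc; apply/eqP; rewrite -subr_eq0; apply/eqP/eq0_normc/eqP.
  rewrite eq_le normc_ge0 andbT -x0.
  pose f i := if i is 0%N then b else c.
  have <- : variation p (val x) 1 f = normc (val x c - val x b).
    by rewrite /variation big_ord1/= -powRrM mulfV ?gt_eqF// powRr1.
  by apply: variation_le_norm; case.
have {}xE : val x = cst (val x a).
  by apply/funext => b; case: (ltgtP a b) => [|/xE|->] //; exact: xE.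
have F := tails_filter.
have /in_jamesP[_ xa _] := valP x; rewrite xE in xa.
have xa' : cst (val x a) @ tails --> (val x a : R[i]^o) by exact: cvg_cst.
rewrite [LHS](_ : _ = val x a)//.
exact: (cvg_unique (@norm_hausdorff _ R[i]^o) xa' xa).
Qed.

HB.instance Definition _ := Lmodule_isNormed.Build R[i] james
  james_normD james_normZ james_norm_eq0.

End LongJamesSpace.

(* Main.v *)
Require Import Defs.
From HB Require Import structures.
From mathcomp Require Import all_boot all_order all_algebra generic_quotient.
From mathcomp Require Import complex ring.
From mathcomp Require Import all_classical all_reals all_analysis.

(* An operator T on J has a diagonal: since functions of bounded p-variation on
   [0, omega_1[ are eventually constant, there are a scalar l and a club C such
   that (T x)(a) = l x(a) for all x and all a in C, and T |-> l is a character.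
   Composition with t |-> min {a in C | t <= a} is an idempotent E of J, and
   E T = l E. Hence, if e is an idempotent matrix over B(J), d the scalar matrix
   of its diagonals and C a club that works for all its entries, then E e = d E,
   so [e] = [e (1 - E)] + [d E], and likewise for d. The range of 1 - E is the
   space of functions vanishing on C, an l^p-sum of spaces J(gap) over the gaps
   of C. The countable l^p-sum of this space with itself is again complemented
   in J, as one sees by splitting omega_1 into consecutive blocks isomorphic to
   [0, c], infinitely many for each c. An Eilenberg swindle then kills the
   classes of the idempotents living on 1 - E, so that [e] = [d] is a multiple of
   the class of 1, by the rank of d. *)

Set Implicit Arguments.
Unset Strict Implicit.
Unset Printing Implicit Defensive.

Import Order.TTheory GRing.Theory Num.Theory.
Import numFieldNormedType.Exports ComplexField.Normc.

Local Open Scope classical_set_scope.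
Local Open Scope ring_scope.

(** * Order types omega_1 and clubs *)

(** The swindle must be confined to the complement of E, since on all of J it would annihilate the
    class of 1 as well. What makes it possible there is that a function vanishing on C can be moved
    gap by gap into disjoint blocks and extended by zero: an increment of the result that leaves a
    gap is compared with a zero of the function at the end of that gap. The gap ending at c goes
    into a block (c, n), and n numbers the copies. Continuity amounts to left continuity, and the
    first point of a block (c, 0) may be a limit of earlier blocks; so the copies with n = 0 stay
    empty and the swindle starts at n = 1. The map back reads a block relative to the value at its
    last point, which restores the zeros on C. The diagonal exists because omega_1 has uncountable
    cofinality and because p > 1 prevents functionals from having mass near omega_1. *)

Section Omega1.
Local Open Scope order_scope.
Context {d : Order.disp_t} {W : orderType d} (hW : is_omega1 W).
Implicit Types (a b c : W) (A : set W).

Lemma omega1_min A : A !=set0 -> exists2 z, A z & forall b, A b -> z <= b.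
Proof.
case: hW => wo _ _ [a Aa].
have [|z [[zA zmin] _]] := wo [pred b | `[< A b >]]; first by exists a; apply/asboolP.
by exists z => [|b Ab]; [exact/asboolP|apply: zmin; exact/asboolP].
Qed.

Lemma omega1_ind (P : W -> Prop) :
  (forall a, (forall b, b < a -> P b) -> P a) -> forall a, P a.
Proof.
move=> ih a; apply: contrapT => na.
have [z nz zmin] := @omega1_min [set b | ~ P b] (ex_intro _ a na).
apply: nz; apply: ih => b bz; apply: contrapT => nb.
by have := zmin _ nb; rewrite leNgt bz.
Qed.

(** Otherwise the chain would be a countable union of countable initial segments. *)
Lemma omega1_ub A : countable A -> exists b, forall a, A a -> a < b.
Proof.
case: hW => _ unc cnt cA; apply: contrapT => nb; apply: unc.
have -> : [set: W] = \bigcup_(a in A) [set b | b <= a].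
  apply/seteqP; split=> // b _; apply: contrapT => nab; apply: nb; exists b => a Aa.
  by rewrite ltNge; apply/negP => ba; apply: nab; exists a.
apply: bigcup_countable => // a Aa.
have /countable_injP[f finj] := cnt a.
apply/countable_injP; exists (fun b => if b == a then 0%N else (f b).+1) => b c.
rewrite !inE /= !le_eqVlt; have [->|_] := eqVneq b a; have [->|_] := eqVneq c a => //= ba ca.
by case=> /finj; apply; rewrite inE.
Qed.

Lemma omega1_succ a : exists b, a < b.
Proof.
by have [b bP] := @omega1_ub [set a] (finite_set_countable (finite_set1 a)); exists b; exact: bP.
Qed.

Lemma omega1_seq_ub (I : countType) (f : I -> W) : exists b, forall n, f n < b.
Proof.
have [|b bP] := @omega1_ub (range f); last by exists b => n; apply: bP; exists n.
by apply: sub_countable (countableP _); exact: card_image_le.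
Qed.

(** The bound [g] dominates [f] on whole initial segments, which makes up for a lack of monotonicity
    of [f] when [g] is iterated. *)
Lemma omega1_fun_ub (f : W -> W) : exists g, forall a b, a <= b -> f a < g b.
Proof.
have H b : exists c, forall a, a <= b -> f a < c.
  have [|c cP] := @omega1_ub [set f a | a in [set a | a <= b]]; last first.
    by exists c => a ab; apply: cP; exists a.
  apply: sub_countable; first exact: card_image_le.
  have [b' bb'] := omega1_succ b.
  case: hW => _ _ /(_ b'); apply: sub_countable; apply: subset_card_le => a /=.
  by move/le_lt_trans; apply.
by have [g gP] := choice H; exists g => a b; exact: gP.
Qed.

End Omega1.

(* Any two such orders are isomorphic: send each point to the least strict upper
   bound of the images of its predecessors. *)
Section Omega1Iso.
Local Open Scope order_scope.
Context {d : Order.disp_t} {W : orderType d} (hW : is_omega1 W).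
Context {X : Type} (lt : X -> X -> Prop).
Hypotheses (lt_wf : well_founded lt)
  (lt_total : forall x y, [\/ lt x y, x = y | lt y x])
  (lt_countable : forall x, countable [set y | lt y x])
  (X_uncountable : ~ countable [set: X]).

Lemma omega1_iso : exists h : X -> W,
  (forall x y, lt x y -> h x < h y) /\ (forall a, exists x, h x = a).
Proof.
pose P (x : X) (g : X -> W) (a : W) :=
  (forall y, lt y x -> g y < a) /\
  (forall b, (forall y, lt y x -> g y < b) -> a <= b).
have Pex x g : exists a, P x g a.
  have [|a aub amin] := @omega1_min _ _ hW [set a | forall y, lt y x -> g y < a].
    have [|b bP] := @omega1_ub _ _ hW [set g y | y in [set y | lt y x]].
      by apply: sub_countable (lt_countable x); exact: card_image_le.
    by exists b => y yx; apply: bP; exists y.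
  by exists a.
have [w0] := is_omega1_nonempty hW.
pose F (x : X) (rec : forall y, lt y x -> W) : W :=
  projT1 (cid (Pex x (fun y => if pselect (lt y x) is left yx then rec y yx else w0))).
pose h := Fix lt_wf (fun=> W) F.
have hP x : P x h (h x).
  rewrite {2}/h Fix_eq => [|y f g fg]; last first.
    by congr (F y _); apply: functional_extensionality_dep => z;
       apply: functional_extensionality_dep => zy; exact: fg.
  rewrite -/h /F; case: cid => a /= [a1 a2]; split=> [y yx|b bP].
    by have := a1 y yx; case: pselect.
  by apply: a2 => y yx; case: pselect => // ?; exact: bP.
exists h; have hlt x y : lt x y -> h x < h y by have [h1 _] := hP y; exact: h1.
split=> // a; apply: contrapT => na.
(* Some value exceeds [a]: otherwise [h] would embed the uncountable [X] into the countable set of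
   predecessors of [a]. *)
have [x xa] : exists x, a < h x.
  apply: contrapT => nx; apply: X_uncountable.
  have hinj : injective h.
    by move=> x y hxy; have [/hlt|//|/hlt] := lt_total x y; rewrite hxy ltxx.
  have ha x : h x < a.
    rewrite lt_neqAle leNgt; apply/andP; split; first by apply/eqP => ?; apply: na; exists x.
    by apply/negP => ?; apply: nx; exists x.
  have [_ _ /(_ a) /countable_injP [f finj]] := hW.
  apply/countable_injP; exists (f \o h) => x y _ _ fxy.
  by apply: hinj; apply: finj fxy; rewrite inE /=.
(* The image has no gaps: the predecessors of [x] miss [a] and by induction do not exceed it, so the
   minimality of [h x] gives h x <= a. *)
elim: (lt_wf x) xa => {}x _ ih xa.
have [_ hx] := hP x; suff : h x <= a by rewrite leNgt xa.
apply: hx => y yx.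
rewrite lt_neqAle; apply/andP; split; first by apply/eqP => ya; apply: na; exists y.
by rewrite leNgt; apply/negP => ay; exact: ih yx ay.
Qed.

End Omega1Iso.

Section Blocks.
Local Open Scope order_scope.
Context {d : Order.disp_t} {W : orderType d} (hW : is_omega1 W).

Definition block_lt (u v : W * nat * W) :=
  u.1.1 < v.1.1 \/ u.1.1 = v.1.1 /\
    ((u.1.2 < v.1.2)%N \/ u.1.2 = v.1.2 /\ u.2 < v.2).

(* A copy of W split into consecutive blocks (c, n), lexicographically ordered,
   the block (c, n) being a copy of [0, c]. *)
Lemma omega1_blocks : exists (h : W -> nat -> W -> W) (co : W -> W * nat * W),
  [/\ forall w, (co w).2 <= (co w).1.1,
      forall w, h (co w).1.1 (co w).1.2 (co w).2 = w,
      forall c n t, t <= c -> co (h c n t) = (c, n, t) &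
      forall u v, u < v <-> block_lt (co u) (co v)].
Proof.
pose X := {q : W * nat * W | q.2 <= q.1.1}.
pose lt (u v : X) := block_lt (val u) (val v).
have lt_total u v : [\/ lt u v, u = v | lt v u].
  have H : val u = val v -> u = v by exact: val_inj.
  move: H; case: u v => [[[c n] t] u] [[[c' n'] t'] v]; rewrite /lt /block_lt /= => H.
  case: (ltgtP c c') => [?|?|cc']; [by apply: Or31; left|by apply: Or33; left|].
  case: (ltngtP n n') => [?|?|nn']; [by apply: Or31; right; split => //; left|
    by apply: Or33; right; split => //; left|].
  case: (ltgtP t t') => [?|?|tt'];
    [by apply: Or31; right; split => //; right|by apply: Or33; right; split => //; right|].
  by apply: Or32; apply: H; rewrite cc' nn' tt'.
have lt_wf : well_founded lt.
  move=> [[[c n] t] u]; move: c n t u.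
  apply: (omega1_ind hW) => c ihc; elim/ltn_ind => n ihn.
  apply: (omega1_ind hW) => t iht u; constructor => -[[[c' n'] t'] u'].
  case=> /= [/ihc|[cc [nn|[nn tt]]]]; first exact.
  - by subst c'; exact: ihn.
  - by subst c' n'; exact: iht.
have [a0] := is_omega1_nonempty hW.
have cntle (c : W) : countable [set b | b <= c].
  have [c' cc'] := omega1_succ hW c.
  case: hW => _ _ /(_ c'); apply: sub_countable; apply: subset_card_le => a /=.
  by move/le_lt_trans; apply.
have lt_countable x : countable [set y | lt y x].
  pose B := ([set b | b <= (val x).1.1] `*` [set: nat]) `*` [set b | b <= (val x).1.1].
  have yB y : lt y x -> val y \in B.
    rewrite inE => yx; have yl := valP y.
    have y1 : (val y).1.1 <= (val x).1.1 by case: yx => [/ltW|[-> _]].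
    by split; [split|exact: le_trans y1].
  have /countable_injP[f finj] : countable B.
    by apply: countableX => //; apply: countableX.
  apply/countable_injP; exists (f \o val) => y z; rewrite !inE => yx zx /= fyz.
  by apply: val_inj; apply: finj => //; exact: yB.
have X_uncountable : ~ countable [set: X].
  move=> /countable_injP[f finj]; case: hW => _ + _; apply.
  apply/countable_injP; exists (fun c => f (Sub (c, 0%N, c) (lexx c))) => b c _ _ fbc.
  by have /(congr1 val)[] := finj _ _ (in_setT _) (in_setT _) fbc.
have [h [hlt hsurj]] := @omega1_iso _ W hW X lt lt_wf lt_total lt_countable X_uncountable.
have hinj : injective h.
  by move=> x y hxy; have [/hlt|//|/hlt] := lt_total x y; rewrite hxy ltxx.
have [g gP] := choice hsurj.
have gK x : g (h x) = x by apply: hinj; rewrite gP.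
exists (fun c n t => if insub (c, n, t) is Some x then h x else a0), (fun w => val (g w)).
split=> [w|w|c n t tc|u v].
- exact: (valP (g w)).
- by move: (gP w); case: (g w) => -[[c n] t] /= tc hw; rewrite insubT.
- by rewrite insubT /= gK.
rewrite -[block_lt _ _]/(lt (g u) (g v)); split=> [uv|/hlt]; last by rewrite !gP.
have [//|guv|/hlt] := lt_total (g u) (g v); move: uv; rewrite -(gP u) -(gP v) !gK.
  by rewrite guv ltxx.
by move=> /ltW; rewrite leNgt => /negP.
Qed.

End Blocks.

Section Clubs.
Local Open Scope order_scope.
Context {d : Order.disp_t} {W : orderType d} (hW : is_omega1 W).
Implicit Types (s : W -> W) (a b c t : W).

(* The sets of this form are closed and unbounded, and are stable under finite
   intersections, through the pointwise maximum of the functions s. *)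
Definition club s : set W := [set a | (exists b, b < a) /\ forall b, b < a -> s b < a].

(** The witness is the supremum of the iterates of [t] under a function that dominates the identity
    and [s] on initial segments: a point below it lies under some iterate, and its image under [s]
    under the next one. *)
Lemma club_unbounded s t : exists2 a, club s a & t < a.
Proof.
have [g gP] := omega1_fun_ub hW (fun b => Order.max b (s b)).
have gt b : b < g b by have := gP b b (lexx b); rewrite gt_max => /andP[].
pose f n := iter n g t.
have [b fb] := omega1_seq_ub hW f.
have [a fa amin] := @omega1_min _ _ hW [set a | forall n, f n < a] (ex_intro _ b fb).
exists a; last exact: (fa 0%N).
split=> [|c ca]; first by exists t; exact: (fa 0%N).
have [n cn] : exists n, c <= f n.
  apply: contrapT => nc; have : a <= c.
    apply: amin => n; rewrite ltNge; apply/negP => cn; by apply: nc; exists n.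
  by rewrite leNgt ca.
by apply: lt_trans (fa n.+1); have := gP _ _ cn; rewrite gt_max => /andP[].
Qed.

Lemma club_maxl s s' a : club (fun t => Order.max (s t) (s' t)) a -> club s a.
Proof.
by case=> a0 aP; split=> // b /aP; rewrite gt_max => /andP[].
Qed.

Lemma club_maxr s s' a : club (fun t => Order.max (s t) (s' t)) a -> club s' a.
Proof.
by case=> a0 aP; split=> // b /aP; rewrite gt_max => /andP[].
Qed.

Lemma club_closed s a : (exists b, b < a) ->
  (forall b, b < a -> exists2 c, club s c & b < c <= a) -> club s a.
Proof.
move=> a0 aP; split=> // b /aP[c [_ cP] /andP[/cP sc ca]].
exact: lt_le_trans ca.
Qed.

Fact club_next_ex s t : exists2 c, club s c /\ t <= c & forall b, club s b /\ t <= b -> c <= b.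
Proof.
by have [c cs /ltW tc] := club_unbounded s t; apply: (omega1_min hW); exists c.
Qed.

Definition club_next s t : W := projT1 (cid2 (club_next_ex s t)).

Lemma club_nextP s t : club s (club_next s t).
Proof. by rewrite /club_next; case: cid2 => c [] []. Qed.

Lemma club_next_ge s t : t <= club_next s t.
Proof. by rewrite /club_next; case: cid2 => c [] []. Qed.

Lemma club_next_le s t a : club s a -> t <= a -> club_next s t <= a.
Proof. by rewrite /club_next; case: cid2 => c [_ _] /= cP sa ta; exact: cP. Qed.

Lemma club_next_id s a : club s a -> club_next s a = a.
Proof. by move=> sa; apply/le_anti; rewrite club_next_ge club_next_le. Qed.

Lemma club_next_mono s t t' : t <= t' -> club_next s t <= club_next s t'.
Proof.
move=> tt'; apply: club_next_le; first exact: club_nextP.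
exact: le_trans (club_next_ge s t').
Qed.

Lemma club_next_between s t u : t <= u -> u <= club_next s t -> club_next s u = club_next s t.
Proof.
move=> tu ut; apply/le_anti/andP; split; last exact: club_next_mono.
by apply: club_next_le => //; exact: club_nextP.
Qed.

End Clubs.

(** * Control functions for the p-variation *)

Section Control.
Context {R : realType} {p : R} (p1 : 1 < p).
Context {d : Order.disp_t} {W : orderType d} (hW : is_omega1 W).
Implicit Types (x y : W -> R[i]^o) (Om : W -> R) (a : nat -> W).

Lemma normc_ge0 (z : R[i]) : 0 <= normc z.
Proof. by case: z => u v; exact: sqrtr_ge0. Qed.

Lemma normc_distC (z w : R[i]) : normc (z - w) = normc (w - z).
Proof. by rewrite -normcN opprB. Qed.

Let p0 : 0 < p. Proof. exact: lt_trans p1. Qed.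

Lemma ler_powR2 (u v : R) : 0 <= u -> u <= v -> u `^ p <= v `^ p.
Proof.
move=> u0 uv; apply: ge0_ler_powR; rewrite ?nnegrE ?(ltW p0)//.
exact: le_trans uv.
Qed.

(** A crude substitute for Minkowski's inequality, for estimates in which only the existence of a
    constant matters. *)
Lemma powR_leD (u v : R) : 0 <= u -> 0 <= v -> (u + v) `^ p <= 2 `^ p * (u `^ p + v `^ p).
Proof.
move=> u0 v0; have [uv|/ltW vu] := leP u v.
  apply: (@le_trans _ _ ((2 * v) `^ p)).
    by apply: ler_powR2; rewrite ?addr_ge0// mulr2n mulrDl !mul1r lerD2r.
  by rewrite powRM// ler_wpM2l ?powR_ge0// lerDr powR_ge0.
apply: (@le_trans _ _ ((2 * u) `^ p)).
  by apply: ler_powR2; rewrite ?addr_ge0// mulr2n mulrDl !mul1r lerD2l.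
by rewrite powRM// ler_wpM2l ?powR_ge0// lerDl powR_ge0.
Qed.

(* Superadditivity of the p-variation turns it into the increments of a
   nondecreasing real function. *)
Definition controls x Om : Prop :=
  forall s t, (s <= t)%O -> normc (x t - x s) `^ p <= Om t - Om s.

Definition pvar_le x (M : R) : Prop :=
  exists2 Om, controls x Om & forall s t, Om t - Om s <= M.

Definition chain n a : Prop := forall i, (i < n)%N -> (a i < a i.+1)%O.

Definition pvar_sum x n a : R := \sum_(i < n) normc (x (a i.+1) - x (a i)) `^ p.

Lemma chain_le n a i j : chain n a -> (i <= j <= n)%N -> (a i <= a j)%O.
Proof.
move=> an; elim: j => [|j ih]; first by rewrite leqn0 => /andP[/eqP ->].
rewrite leq_eqVlt => /andP[/predU1P[-> //|ij] jn].
by apply: le_trans (ltW (an j jn)); apply: ih; rewrite -ltnS ij ltnW.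
Qed.

Lemma pvar_sum_le_controls x Om n a : controls x Om -> chain n a ->
  pvar_sum x n a <= Om (a n) - Om (a 0%N).
Proof.
move=> xO; elim: n => [|n ih] an; first by rewrite /pvar_sum big_ord0 subrr.
rewrite /pvar_sum big_ord_recr /= -/(pvar_sum x n a).
have -> : Om (a n.+1) - Om (a 0%N) = (Om (a n) - Om (a 0%N)) + (Om (a n.+1) - Om (a n)).
  by ring.
apply: lerD; first by apply: ih => i /ltnW; exact: an.
by apply: xO; apply/ltW/an.
Qed.

Lemma pvar_sum_le x M n a : pvar_le x M -> chain n a -> pvar_sum x n a <= M.
Proof.
move=> [Om xO OM] an; exact: le_trans (pvar_sum_le_controls xO an) (OM _ _).
Qed.

Lemma pvar_le_ge0 x M : pvar_le x M -> 0 <= M.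
Proof.
move=> xM; have [a0] := is_omega1_nonempty hW.
have := @pvar_sum_le x M 0 (fun=> a0) xM; rewrite /pvar_sum big_ord0.
by apply.
Qed.

(** The control function at [w] is the p-variation up to [w], the supremum over chains that end at
    or before [w]. A chain ending before [s] is first prolonged to [s], which does not decrease its
    sum, and then to [t], which adds exactly the required increment. *)
Lemma pvar_leP x M : (forall n a, chain n a -> pvar_sum x n a <= M) -> pvar_le x M.
Proof.
move=> xM.
pose V w := [set r | exists n a, [/\ chain n a, (a n <= w)%O & r = pvar_sum x n a]].
have V0 w : V w 0 by exists 0%N, (fun=> w); split; rewrite // /pvar_sum big_ord0.
have Vub w : has_sup (V w).
  by split; [exists 0|exists M => _ [n [a [an _ ->]]]; exact: xM].
pose ext n a (w : W) i := if (i <= n)%N then a i else w.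
have extP n a w : chain n a -> (a n < w)%O -> chain n.+1 (ext n a w) /\
    pvar_sum x n.+1 (ext n a w) = pvar_sum x n a + normc (x w - x (a n)) `^ p.
  move=> an aw; split=> [i|].
    rewrite ltnS leq_eqVlt /ext => /predU1P[->|ni]; first by rewrite leqnn ltnn.
    by rewrite (ltnW ni) ni; exact: an.
  rewrite /pvar_sum big_ord_recr /= /ext leqnn ltnn; congr (_ + _).
  by apply: eq_bigr => i _; rewrite (ltnW (ltn_ord i)) (ltn_ord i).
exists (fun w => sup (V w)); last first.
  move=> s t; rewrite lerBlDr.
  have sM w : sup (V w) <= M.
    by apply: ge_sup; [exists 0|move=> _ [n [a [an _ ->]]]; exact: xM].
  have s0 : 0 <= sup (V s) by apply: ub_le_sup => //; case: (Vub s).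
  by rewrite (le_trans (sM t))// lerDl.
move=> s t; rewrite le_eqVlt => /predU1P[->|st].
  by rewrite !subrr /normc /= expr0n addr0 sqrtr0 powR0 ?gt_eqF.
rewrite lerBrDr addrC -lerBrDr; apply: ge_sup; first by exists 0.
move=> _ [n [a [an aw ->]]]; rewrite lerBrDr.
have last_s m b : chain m b -> b m = s ->
    pvar_sum x m b + normc (x t - x s) `^ p <= sup (V t).
  move=> bm bs; apply: ub_le_sup; first by case: (Vub t).
  have [bc bE] : chain m.+1 (ext m b t) /\ _ := extP m b t bm ltac:(by rewrite bs).
  by exists m.+1, (ext m b t); rewrite bE bs; split => //; rewrite /ext ltnn.
move: aw; rewrite le_eqVlt => /predU1P[|aw]; first exact: last_s.
have [bc bE] := extP n a s an aw.
apply: le_trans (last_s n.+1 (ext n a s) bc _); last by rewrite /ext ltnn.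
by rewrite bE lerD2r lerDl powR_ge0.
Qed.

Lemma pvar_le_weak x M N : pvar_le x M -> M <= N -> pvar_le x N.
Proof. by move=> [Om xO OM] MN; exists Om => // s t; exact: le_trans MN. Qed.

Lemma pvar_le_comp x M (f : W -> W) : {homo f : s t / (s <= t)%O} ->
  pvar_le x M -> pvar_le (x \o f) M.
Proof. by move=> fm [Om xO OM]; exists (Om \o f) => [s t st|s t]; [exact/xO/fm|exact: OM]. Qed.

Lemma pvar_leB x y M N : pvar_le x M -> pvar_le y N ->
  pvar_le (fun t => x t - y t) (2 `^ p * (M + N)).
Proof.
move=> [Om xO OM] [On yO ON]; exists (fun t => 2 `^ p * (Om t + On t)) => s t.
  move=> st; have -> : x t - y t - (x s - y s) = (x t - x s) + - (y t - y s) by ring.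
  apply: (le_trans (ler_powR2 (normc_ge0 _) (le_normcD _ _))).
  apply: (le_trans (powR_leD (normc_ge0 _) (normc_ge0 _))).
  rewrite normcN -mulrBr ler_wpM2l ?powR_ge0//.
  have -> : Om t + On t - (Om s + On s) = (Om t - Om s) + (On t - On s) by ring.
  by apply: lerD; [exact: xO|exact: yO].
rewrite -mulrBr ler_wpM2l ?powR_ge0//.
have -> : Om t + On t - (Om s + On s) = (Om t - Om s) + (On t - On s) by ring.
exact: lerD.
Qed.

(* Each increment of the sum involves at most two nonzero terms. *)
Lemma pvar_le_sum n (x : 'I_n -> W -> R[i]^o) (M : 'I_n -> R) :
  (forall i j t, i != j -> x i t = 0 \/ x j t = 0) ->
  (forall i, pvar_le (x i) (M i)) ->
  pvar_le (fun t => \sum_(i < n) x i t) (2 `^ p * \sum_(i < n) M i).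
Proof.
move=> xx xM.
have [Om OmP] : exists Om : 'I_n -> W -> R, forall i,
    controls (x i) (Om i) /\ forall s t, Om i t - Om i s <= M i.
  have H i : exists Om, controls (x i) Om /\ forall s t, Om t - Om s <= M i.
    by have [Om ? ?] := xM i; exists Om.
  by have [Om OmP] := choice H; exists Om.
exists (fun t => 2 `^ p * \sum_(i < n) Om i t) => s t.
  move=> st; rewrite -mulrBr -!sumrB.
  have main (i j : 'I_n) : (forall k, k != i -> x k t = 0) -> (forall k, k != j -> x k s = 0) ->
     normc (\sum_(k < n) (x k t - x k s)) `^ p <= 2 `^ p * \sum_(k < n) (Om k t - Om k s).
    move=> it js.
    have le1 : \sum_(k < n) normc (x k t - x k s) `^ p <= \sum_(k < n) (Om k t - Om k s).
      by apply: ler_sum => k _; apply: (OmP k).1.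
    apply: le_trans (ler_wpM2l (powR_ge0 _ _) le1).
    have [ij|ij] := eqVneq i j.
      subst j; rewrite (bigD1 i)//= big1 ?addr0; last first.
        by move=> k ki; rewrite it// js// subrr.
      rewrite (bigD1 i)//= mulrDr; apply: (@le_trans _ _ (2 `^ p * normc (x i t - x i s) `^ p)).
        rewrite ler_peMl ?powR_ge0// -[leLHS](powRr0 2); apply: ler_powR; last exact: ltW.
        by rewrite ler1n.
      by rewrite lerDl mulr_ge0 ?powR_ge0// sumr_ge0// => k _; exact: powR_ge0.
    have E : forall (V : nmodType) (F : 'I_n -> V), \sum_(k < n) F k =
        F i + F j + \sum_(k < n | (k != i) && (k != j)) F k.
      by move=> V F; rewrite (bigD1 i)//= (bigD1 j) ?addrA//= eq_sym.
    rewrite !E big1 ?addr0; last by move=> k /andP[ki kj]; rewrite it// js// subrr.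
    apply: (le_trans (ler_powR2 (normc_ge0 _) (le_normcD _ _))).
    apply: (le_trans (powR_leD (normc_ge0 _) (normc_ge0 _))).
    rewrite ler_wpM2l ?powR_ge0// lerDl.
    by rewrite sumr_ge0// => k _; exact: powR_ge0.
  have pick w : (exists i, forall k, k != i -> x k w = 0) \/ n = 0%N.
    have [/existsP[i xi]|] := boolP [exists i, x i w != 0].
      left; exists i => k ki; have [//|xi0] := xx _ _ w ki.
      by rewrite xi0 eqxx in xi.
    rewrite negb_exists => /forallP x0; have [n0|n0] := eqVneq n 0%N; first by right.
    move: n0; rewrite -lt0n => n0; left; exists (Ordinal n0) => k _.
    by apply/eqP; move: (x0 k); rewrite negbK.
  have [[i it]|n0] := pick t; last first.
    by subst n; rewrite !big_ord0 mulr0 /normc /= expr0n addr0 sqrtr0 powR0 ?gt_eqF.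
  have [[j js]|n0] := pick s; first exact: main it js.
  by subst n; rewrite !big_ord0 mulr0 /normc /= expr0n addr0 sqrtr0 powR0 ?gt_eqF.
rewrite -mulrBr -sumrB ler_wpM2l ?powR_ge0//.
by apply: ler_sum => i _; apply: (OmP i).2.
Qed.

(** Take [s] in [S] where [Om] is within [e] of its supremum on [S]. With [S] the whole chain this
    controls tails, with [S] the predecessors of a point it gives left limits. *)
Lemma controls_osc x Om M (S : set W) e : controls x Om -> (forall s t, Om t - Om s <= M) ->
  S !=set0 -> 0 < e -> exists2 s, S s & forall t, S t -> (s <= t)%O -> Om t - Om s < e.
Proof.
move=> xO OM [s0 Ss0] e0.
have ub : has_sup [set Om t | t in S].
  split; first by exists (Om s0), s0.
  by exists (Om s0 + M) => _ [t _ <-]; rewrite -lerBlDl.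
have [_ [s Ss <-] sP] := sup_adherent e0 ub.
exists s => // t St st; rewrite ltrBlDr.
apply: (@le_lt_trans _ _ (sup [set Om t | t in S])).
  by apply: ub_le_sup; [case: ub|exists t].
by rewrite -ltrBlDl.
Qed.

Lemma powR_lt_inv (u v : R) : 0 <= v -> u `^ p < v `^ p -> u < v.
Proof.
by move=> v0 uv; rewrite ltNge; apply/negP => /(ler_powR2 v0); rewrite leNgt uv.
Qed.

Lemma powR_le_inv (u v : R) : 0 <= u -> 0 <= v -> u `^ p <= v `^ p -> u <= v.
Proof.
move=> u0 v0 uv; rewrite leNgt; apply/negP => vu.
have : v `^ p < u `^ p by apply: gt0_ltr_powR; rewrite ?nnegrE.
by rewrite ltNge uv.
Qed.

Lemma pvar_le_osc x M (S : set W) e : pvar_le x M -> S !=set0 -> 0 < e ->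
  exists2 s, S s & forall t u, S t -> S u -> (s <= t)%O -> (s <= u)%O -> normc (x t - x u) < e.
Proof.
move=> [Om xO OM] S0 e0.
have [s Ss sP] := controls_osc xO OM S0 (powR_gt0 p e0).
exists s => // t u; wlog tu : t u / (t <= u)%O.
  move=> H St Su; have [|/ltW] := leP t u; first by move=> /H; exact.
  by move=> /H ut ? ?; rewrite normc_distC; exact: ut.
move=> St Su st su; rewrite normc_distC; apply: powR_lt_inv; first exact: ltW.
apply: le_lt_trans (xO _ _ tu) _; apply: le_lt_trans (sP _ Su su).
rewrite lerB// -subr_ge0; apply: le_trans (xO _ _ st); exact: powR_ge0.
Qed.

(** Beyond suitable points the oscillation is below 1, 1/2, 1/3, ...; countably many points have a
    common bound, beyond which it is zero. *)
Lemma pvar_le_eventually_cst x M : pvar_le x M -> exists b : W, forall t, (b <= t)%O -> x t = x b.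
Proof.
move=> xM; have [w0] := is_omega1_nonempty hW.
have H (n : nat) : exists s, forall t u, (s <= t)%O -> (s <= u)%O -> normc (x t - x u) < n.+1%:R^-1.
  have n0 : 0 < n.+1%:R^-1 :> R by rewrite invr_gt0.
  have [s _ sP] := @pvar_le_osc x M setT _ xM (ex_intro _ w0 I) n0.
  by exists s => t u; exact: sP.
have [f fP] := choice H; have [a fa] := omega1_seq_ub hW f.
exists a => t at_; apply/eqP; rewrite -subr_eq0; apply/eqP/eq0_normc/eqP.
rewrite eq_le normc_ge0 andbT; apply/ler_addgt0Pl => e e0; rewrite addr0.
have [n ne] : exists n, n.+1%:R^-1 < e.
  have [n _ nP] := near_infty_natSinv_lt (PosNum e0); exists n; exact: (nP n (leqnn n)).
apply: ltW; apply: lt_trans ne; apply: fP; last exact/ltW.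
by apply: le_trans at_; exact/ltW.
Qed.

(** This is continuity for the order topology: every point [w] has an immediate successor, so the
    intervals ]s, w] form a base of its neighbourhoods, unless [w] is the first point, which is
    isolated. *)
Definition left_cont x : Prop := forall w e, (exists v, (v < w)%O) -> 0 < e ->
  exists2 s, (s < w)%O & forall u, (s < u < w)%O -> normc (x u - x w) < e.

(** Bounded p-variation provides left limits, so it suffices to approach the value at [w] along some
    points arbitrarily close to [w]; at points that are not limits nothing has to be checked. *)
Lemma left_cont_frequently x M : pvar_le x M ->
  (forall w s e, (s < w)%O -> 0 < e -> (forall v, (v < w)%O -> exists u, (v < u < w)%O) ->
     exists2 u, (s < u < w)%O & normc (x u - x w) < e) -> left_cont x.
Proof.
move=> xM xP w e [v vw] e0.
have [lim|] := pselect (forall v, (v < w)%O -> exists u, (v < u < w)%O); last first.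
  move=> /existsNP[s /not_implyP[sw sP]]; exists s => // u suw.
  by exfalso; apply: sP; exists u.
have [|s sw sP] := @pvar_le_osc x M [set t | (t < w)%O] (e / 2) xM _ (divr_gt0 e0 (ltr0n _ 2)).
  by exists v.
exists s => // u /andP[su uw].
have [u' /andP[su' uw'] xu'] := xP w s (e / 2) sw (divr_gt0 e0 (ltr0n _ 2)) lim.
have -> : x u - x w = (x u - x u') + (x u' - x w) by ring.
rewrite (splitr e); apply: le_lt_trans (le_normcD _ _) _.
by apply: ltrD => //; apply: sP => //; exact/ltW.
Qed.

End Control.
Arguments controls {R} p {d W} x Om.
Arguments pvar_le {R} p {d W} x M.
Arguments pvar_sum {R} p {d W} x n a.

(** * Membership in the long James space *)

Lemma cvg_normcP {R : realType} {T : Type} (F : set_system T) {FF : Filter F}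
    (x : T -> R[i]^o) (l : R[i]^o) :
  x @ F --> l <-> forall e : R, 0 < e -> \forall t \near F, normc (x t - l) < e.
Proof.
rewrite (@cvgrPdistC_lt _ R[i]^o); split=> H e e0.
  have e0' : 0 < (e%:C)%C by rewrite -(rmorph0 (real_complex R)) ltcR.
  by apply: filterS (H _ e0') => t; rewrite -ltcR.
have : 0 < complex.Re e by move: e0; rewrite ltcE /= => /andP[].
move=> /H; apply: filterS => t; rewrite ltcE /=.
by move: e0; rewrite ltcE /= => /andP[/eqP -> _]; rewrite eqxx.
Qed.

Section Membership.
Context {R : realType} {p : R} (p1 : 1 < p).
Context {d : Order.disp_t} {W : orderTopologicalType d} (hW : is_omega1 W).
Implicit Types (x y : W -> R[i]^o).

Let p0 : 0 < p. Proof. exact: lt_trans p1. Qed.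

Lemma itv_left (i : interval W) v w : itv_open_ends i -> w \in i -> (v < w)%O ->
  exists2 s, (s < w)%O & forall t, (s < t < w)%O -> t \in i.
Proof.
case: i => l r io; rewrite itv_boundlr => /andP[lw wr] vw.
have tr t : (t < w)%O -> (BRight t <= r)%O.
  by move=> tw; apply: le_trans wr; rewrite bnd_simp ltW.
case: l io lw => [[] s|[]] io lw.
- by case: r io {wr tr} => [[]|[]].
- exists s; first by move: lw; rewrite bnd_simp.
  by move=> t /andP[st tw]; rewrite itv_boundlr tr// andbT bnd_simp.
- by exists v => // t /andP[st tw]; rewrite itv_boundlr tr// andbT.
- by [].
Qed.

Lemma left_contP x : continuous x <-> left_cont x.
Proof.
split=> H w.
  move=> e [v vw] e0.
  have /cvg_normcP/(_ e e0) := H w.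
  rewrite /nbhs /= -/(nbhs w) itv_nbhsE => -[i [io wi] iP].
  have [s sw sP] := itv_left io wi vw.
  by exists s => // u /sP; exact: iP.
apply/cvg_normcP => e e0.
have [u wu] := omega1_succ hW w.
have wu' : \forall t \near w, (t <= w)%O.
  have [u' wu' u'P] := omega1_min hW (A := [set t | (w < t)%O]) (ex_intro _ u wu).
  have : nbhs w [set` `]-oo, u'[%O].
    by apply: open_nbhs_nbhs; split; [exact: lray_open|rewrite /= in_itv].
  apply: filterS => t; rewrite /= in_itv /= => tu; rewrite leNgt; apply/negP => /u'P.
  by rewrite leNgt tu.
have xw0 : normc (x w - x w) < e.
  by rewrite subrr /normc /= expr0n addr0 sqrtr0.
have [[v vw]|w0] := pselect (exists v, (v < w)%O); last first.
  apply: filterS wu' => t; rewrite le_eqVlt => /predU1P[->//|tw].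
  by exfalso; apply: w0; exists t.
have [s sw sP] := H w e (ex_intro _ v vw) e0.
have ws' : \forall t \near w, (s < t)%O.
  have : nbhs w [set` `]s, +oo[%O].
    by apply: open_nbhs_nbhs; split; [exact: rray_open|rewrite /= in_itv /= sw].
  by apply: filterS => t; rewrite /= in_itv /= andbT.
apply: filterS2 wu' ws' => t; rewrite le_eqVlt => /predU1P[->//|tw] st.
by apply: sP; rewrite st.
Qed.

Lemma eventually0P x M : pvar_le p x M ->
  x @ tails --> (0 : R[i]^o) <-> exists a, forall t, (a <= t)%O -> x t = 0.
Proof.
have F := tails_filter hW.
move=> xM; split=> [/cvg_normcP H|[a aP]]; last first.
  apply/cvg_normcP => e e0; exists a => // t /= /aP ->.
  by rewrite subrr /normc /= expr0n addr0 sqrtr0.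
have [a aP] := pvar_le_eventually_cst p1 hW xM.
exists a => t /aP ->; apply/eq0_normc/eqP.
rewrite eq_le normc_ge0 andbT; apply/ler_addgt0Pl => e e0; rewrite addr0.
have [b _ bP] := H e e0.
have := bP (Order.max a b); rewrite /= subr0 aP ?le_max ?lexx ?orbT//.
by move=> /(_ isT)/ltW.
Qed.

Lemma variationE x n a : Defs.variation p x n a = pvar_sum p x n a `^ p^-1.
Proof. by []. Qed.

Lemma has_ubound_variations x :
  has_ubound (Defs.variations p x) <-> exists M, pvar_le p x M.
Proof.
split=> [[M xM]|[M xM]].
  exists (M `^ p); apply: (pvar_leP p1) => n a an.
  have s0 : 0 <= pvar_sum p x n a by apply: sumr_ge0 => i _; exact: powR_ge0.
  rewrite -[pvar_sum _ _ _ _]powRr1// -[X in _ `^ X](mulVf (lt0r_neq0 p0)) powRrM.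
  by apply: (ler_powR2 p1 (powR_ge0 _ _)); apply: xM; exists n, a.
exists (M `^ p^-1) => _ [n [a [an ->]]]; rewrite variationE.
have s0 : 0 <= pvar_sum p x n a by apply: sumr_ge0 => i _; exact: powR_ge0.
have sM := pvar_sum_le xM an.
by apply: ge0_ler_powR => //; rewrite ?nnegrE ?invr_ge0 ?(ltW p0)// (le_trans s0).
Qed.

Lemma james_intro x a M : left_cont x -> (forall t, (a <= t)%O -> x t = 0) ->
  pvar_le p x M -> x \in in_james p1 hW.
Proof.
move=> xc xa xM; apply/in_jamesP; split; first exact/left_contP.
  by apply/(eventually0P xM); exists a.
by apply/has_ubound_variations; exists M.
Qed.

Lemma james_left_cont (x : james p1 hW) : left_cont (val x).
Proof. by have /in_jamesP[/left_contP] := valP x. Qed.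

Lemma james_support (x : james p1 hW) : exists a, forall t, (a <= t)%O -> val x t = 0.
Proof.
have /in_jamesP[_ x0 /has_ubound_variations[M xM]] := valP x.
by apply/(eventually0P xM).
Qed.

Definition nrm (x : james p1 hW) : R := james_norm p (val x).

Lemma normE (x : james p1 hW) : `|x| = (nrm x)%:C%C.
Proof. by []. Qed.

Lemma nrm_ge0 (x : james p1 hW) : 0 <= nrm x.
Proof. by rewrite -lecR -normE; exact: normr_ge0. Qed.

Lemma james_pvar (x : james p1 hW) : pvar_le p (val x) (nrm x `^ p).
Proof.
apply: (pvar_leP p1) => n a an.
have s0 : 0 <= pvar_sum p (val x) n a by apply: sumr_ge0 => i _; exact: powR_ge0.
rewrite -[pvar_sum _ _ _ _]powRr1// -[X in _ `^ X](mulVf (lt0r_neq0 p0)) powRrM.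
by apply: (ler_powR2 p1 (powR_ge0 _ _)); exact: variation_le_norm.
Qed.

Lemma nrm_le_pvar (x : james p1 hW) M : pvar_le p (val x) M -> nrm x `^ p <= M.
Proof.
move=> xM; have M0 := pvar_le_ge0 hW xM.
rewrite -[leRHS]powRr1// -[X in _ <= _ `^ X](mulVf (lt0r_neq0 p0)) powRrM.
apply: (ler_powR2 p1 (nrm_ge0 x)); apply: james_norm_le => n a an.
rewrite variationE; apply: ge0_ler_powR; rewrite ?nnegrE ?invr_ge0 ?(ltW p0)//.
  by apply: sumr_ge0 => i _; exact: powR_ge0.
exact: pvar_sum_le an.
Qed.

Lemma james_increment (x : james p1 hW) s t : normc (val x s - val x t) <= nrm x.
Proof.
wlog st : s t / (s <= t)%O.
  by move=> H; have [/H//|/ltW/H] := leP s t; rewrite normc_distC.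
have [Om xO OM] := james_pvar x.
rewrite normc_distC leNgt; apply/negP => lt.
have : nrm x `^ p < normc (val x t - val x s) `^ p.
  by apply: gt0_ltr_powR; rewrite ?nnegrE ?nrm_ge0 ?normc_ge0.
by rewrite ltNge (le_trans (xO s t st) (OM _ _)).
Qed.

Lemma james_eval (x : james p1 hW) t : normc (val x t) <= nrm x.
Proof.
have [a /(_ a (lexx a)) xa] := james_support x.
by have := james_increment x t a; rewrite xa subr0.
Qed.

Definition ind (a : W) : W -> R[i]^o := fun t => if (t <= a)%O then 1 else 0.

Lemma pvar_le_ind a : pvar_le p (ind a) 1.
Proof.
exists (fun t => if (t <= a)%O then 0 else 1) => [s t st|s t]; rewrite /ind; last first.
  by do 2![case: ifP => _]; rewrite ?subr0 ?subrr ?sub0r ?ler01 ?lexx // lerNl (le_trans _ ler01)// oppr_le0.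
have [ta|at_] := leP t a.
  by rewrite (le_trans st ta) !subrr /normc /= expr0n addr0 sqrtr0 powR0 ?gt_eqF.
case: ifP => _; rewrite ?subrr ?subr0 ?sub0r ?normcN.
  by rewrite normc1 powR1.
by rewrite /normc /= expr0n addr0 sqrtr0 powR0 ?gt_eqF.
Qed.

End Membership.

(** * Truncations and functionals *)

Section Functionals.
Context {R : realType} {p : R} (p1 : 1 < p).
Context {d : Order.disp_t} {W : orderTopologicalType d} (hW : is_omega1 W).
Local Notation J := (james p1 hW).
Implicit Types (x y : J) (a b t : W).

Let p0 : 0 < p. Proof. exact: lt_trans p1. Qed.

Let normc00 : normc 0 `^ p = 0 :> R.
Proof. by rewrite /normc /= expr0n addr0 sqrtr0 powR0 ?gt_eqF. Qed.

Lemma valJD x y t : val (x + y) t = val x t + val y t.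
Proof. by []. Qed.
Lemma valJB x y t : val (x - y) t = val x t - val y t.
Proof. by []. Qed.
Lemma valJZ (c : R[i]) x t : val (c *: x) t = c * val x t.
Proof. by []. Qed.
Lemma valJ0 t : val (0 : J) t = 0.
Proof. by []. Qed.
Lemma valJ_sum (I : finType) (F : I -> J) t : val (\sum_i F i) t = \sum_i val (F i) t.
Proof. by elim/big_rec2: _ => // i y1 y2 _ <-. Qed.

Lemma nrmZ (c : R[i]) x : nrm (c *: x) = normc c * nrm x.
Proof.
apply: complexI; rewrite -normE normrZ normE rmorphM /=; congr (_ * _).
Qed.

Lemma nrm0 : nrm (0 : J) = 0.
Proof. by rewrite -(scale0r 0) nrmZ normc0 mul0r. Qed.

Lemma ind_james a : ind a \in in_james p1 hW.
Proof.
have [b ab] := omega1_succ hW a.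
apply: (@james_intro _ _ p1 _ _ hW (ind a) b 1 _ _ (pvar_le_ind p1 a)).
  move=> w e [v vw] e0; have [wa|aw] := leP w a.
    exists v => // u /andP[_ uw]; rewrite /ind wa (le_trans (ltW uw) wa).
    by rewrite subrr /normc /= expr0n addr0 sqrtr0.
  exists a => // u /andP[au uw]; rewrite /ind !leNgt au aw /=.
  by rewrite subrr /normc /= expr0n addr0 sqrtr0.
by move=> t bt; rewrite /ind leNgt (lt_le_trans ab bt).
Qed.

Definition toJ (z : W -> R[i]^o) (zJ : z \in in_james p1 hW) : J := Sub z zJ.

Definition indJ a : J := toJ (ind_james a).

Lemma trunc_james x a : (fun t => if (t <= a)%O then val x t else 0) \in in_james p1 hW.
Proof.
have [b bP] := james_support x.
have [Om xO OM] := james_pvar x.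
apply: (@james_intro _ _ p1 _ _ hW _ b (nrm x `^ p + nrm x `^ p)).
- move=> w e [v vw] e0; have [wa|aw] := leP w a.
    have [s sw sP] := @james_left_cont _ _ p1 _ _ hW x w e (ex_intro _ v vw) e0.
    by exists s => // u /[dup] /andP[_ uw] /sP; rewrite (le_trans (ltW uw) wa).
  exists a => // u /andP[au uw]; rewrite leNgt au /=.
  by rewrite subrr /normc /= expr0n addr0 sqrtr0.
- by move=> t bt; rewrite bP// if_same.
exists (fun t => if (t <= a)%O then Om t else Om a + nrm x `^ p) => s t.
  move=> st; have [ta|at_] := leP t a; first by rewrite (le_trans st ta); exact: xO.
  have [sa|as_] := leP s a; last by rewrite !subrr normc00.
  rewrite sub0r normcN addrAC -[leLHS]add0r; apply: lerD.
    by apply: le_trans (xO _ _ sa); exact: powR_ge0.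
  by apply: (ler_powR2 p1 (normc_ge0 _)); exact: james_eval.
have N0 : 0 <= nrm x `^ p by exact: powR_ge0.
do 2![case: ifP => _].
- by rewrite (le_trans (OM _ _))// lerDl.
- rewrite opprD addrA (le_trans (_ : _ <= nrm x `^ p))// ?lerDl// lerBlDr.
  by rewrite (le_trans (OM _ _))// lerDl.
- by rewrite addrAC lerD2r.
- by rewrite subrr addr_ge0.
Qed.

Definition trunc x a : J := toJ (trunc_james x a).

Lemma truncE x a t : val (trunc x a) t = if (t <= a)%O then val x t else 0.
Proof. by []. Qed.

(** Just below [a], a function differs in norm very little from the constant [val x a]. The values
    are close by left continuity, and the p-variation is small because [Om] hardly grows on a short
    enough interval ]b, a[. *)
Lemma pvar_le_peak x a v e : (v < a)%O -> 0 < e -> exists2 b, (b < a)%O &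
  pvar_le p (fun t => if (b < t <= a)%O then val x t - val x a else 0) (3 * e `^ p).
Proof.
move=> va e0; have ep0 : 0 < e `^ p by exact: powR_gt0.
have [lim|] := pselect (forall b, (b < a)%O -> exists t, (b < t < a)%O); last first.
  move=> /existsNP[b /not_implyP[ba nb]]; exists b => //; exists (fun=> 0) => s t.
    move=> _; have H u : (if (b < u <= a)%O then val x u - val x a else 0) = 0.
      case: ifP => // /andP[bu]; rewrite le_eqVlt => /predU1P[->|ua]; first by rewrite subrr.
      by exfalso; apply: nb; exists u; rewrite bu.
    by rewrite !H !subr0 normc00.
  by rewrite subrr mulr_ge0// ltW.
have [Om xO OM] := james_pvar x.
have Omh s t : (s <= t)%O -> Om s <= Om t.
  by move=> /xO st; rewrite -subr_ge0; apply: le_trans st; exact: powR_ge0.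
have [b ba bP] := controls_osc xO OM (ex_intro [set t | (t < a)%O] v va) ep0.
have close t : (b <= t)%O -> (t < a)%O -> normc (val x t - val x a) <= e.
  move=> bt ta; apply/ler_addgt0Pl => h h0.
  have [s sa sP] := @james_left_cont _ _ p1 _ _ hW x a h (ex_intro _ v va) h0.
  have [u /andP[]] := lim (Order.max s t) ltac:(by rewrite gt_max sa).
  rewrite gt_max => /andP[su tu] ua.
  have -> : val x t - val x a = (val x u - val x a) + (val x t - val x u) by ring.
  apply: le_trans (le_normcD _ _) _; apply: lerD; first by apply/ltW/sP; rewrite su.
  rewrite normc_distC; apply: (powR_le_inv p1 (normc_ge0 _) (ltW e0)).
  apply: le_trans (xO _ _ (ltW tu)) _.
  apply: le_trans (ltW (bP u ua (le_trans bt (ltW tu)))).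
  by rewrite lerB// Omh.
exists b => //.
(* One e^p pays for the jump on entering the window, one for the growth of [Om] inside it, and the
   third for the return to zero at [a]. *)
pose Th t := if (t <= b)%O then 0 else if (t < a)%O then e `^ p + (Om t - Om b) else 3 * e `^ p.
have mid t : (b < t)%O -> (t < a)%O -> 0 <= Om t - Om b < e `^ p.
  move=> bt ta; apply/andP; split; first by rewrite subr_ge0 Omh// ltW.
  by apply: bP => //; exact: ltW.
have pow_close t : (b <= t)%O -> (t < a)%O -> normc (val x t - val x a) `^ p <= e `^ p.
  by move=> bt ta; apply: (ler_powR2 p1 (normc_ge0 _)); exact: close.
have Th0 t : 0 <= Th t <= 3 * e `^ p.
  rewrite /Th; case: (leP t b) => bt; first by rewrite lexx mulr_ge0// ltW.
  case: (ltP t a) => ta; last by rewrite lexx mulr_ge0// ltW.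
  have /andP[m1 m2] := mid t bt ta; rewrite addr_ge0//= ?ltW//.
  have -> : 3 * e `^ p = e `^ p + (e `^ p + e `^ p) by ring.
  by rewrite ler_ltD// (lt_trans m2)// ltrDl.
exists Th => [s t st|s t]; last first.
  have /andP[? _] := Th0 s; have /andP[_ ?] := Th0 t.
  by rewrite lerBlDr (le_trans _ (_ : 3 * e `^ p <= _))// lerDl.
rewrite /Th; case: (leP t b) => bt.
  by rewrite (le_trans st bt) !ltNge (le_trans st bt) /= !subrr normc00.
case: (leP s b) => bs.
  rewrite /= !subr0; case: (ltP t a) => ta.
    rewrite (ltW ta) /=; have /andP[m1 m2] := mid t bt ta.
    by rewrite (le_trans (pow_close _ (ltW bt) ta))// lerDl.
  case: ifP => [ta'|_]; last by rewrite normc00 mulr_ge0// ltW.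
  by rewrite (le_anti (_ : (t <= a <= t)%O)) ?ta ?ta' // subrr normc00 mulr_ge0// ltW.
case: (ltP t a) => ta.
  rewrite (le_lt_trans st ta) (ltW ta) (ltW (le_lt_trans st ta)) /=.
  have -> : e `^ p + (Om t - Om b) - (e `^ p + (Om s - Om b)) = Om t - Om s by ring.
  have -> : val x t - val x a - (val x s - val x a) = val x t - val x s by ring.
  exact: xO.
have -> : (if true && (t <= a)%O then val x t - val x a else 0) = 0.
  by case: ifP => //= ta'; rewrite (le_anti (_ : (t <= a <= t)%O)) ?ta ?ta' // subrr.
rewrite sub0r normcN; case: (ltP s a) => sa.
  rewrite (ltW sa) /= (le_trans (pow_close _ (ltW bs) sa))//.
  have /andP[m1 m2] := mid s bs sa.
  have -> : 3 * e `^ p = e `^ p + (e `^ p + e `^ p) by ring.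
  rewrite opprD addrACA subrr add0r -addrA lerDl subr_ge0.
  exact: ltW.
rewrite subrr.
case: ifP => /= [sa'|_]; last by rewrite normc00.
by rewrite (le_anti (_ : (s <= a <= s)%O)) ?sa ?sa' // subrr normc00.
Qed.

Definition functional (f : J -> R[i]) : Prop :=
  (forall (c : R[i]) x y, f (c *: x + y) = c * f x + f y) /\
  exists2 m : R, 0 <= m & forall x, normc (f x) <= m * nrm x.

Lemma functional0 f : functional f -> f 0 = 0.
Proof.
move=> [fl _]; have := fl 1 0 0; rewrite scale1r addr0 mul1r => /eqP.
by rewrite -subr_eq0 opprD addNKr oppr_eq0 => /eqP.
Qed.

Lemma functionalD f x y : functional f -> f (x + y) = f x + f y.
Proof. by move=> [fl _]; rewrite -{1}[x]scale1r fl mul1r. Qed.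

Lemma functionalZ f (c : R[i]) x : functional f -> f (c *: x) = c * f x.
Proof. by move=> ff; have [fl _] := ff; rewrite -{1}[c *: x]addr0 fl functional0// addr0. Qed.

Lemma functionalB f x y : functional f -> f (x - y) = f x - f y.
Proof. by move=> ff; rewrite functionalD// -scaleN1r functionalZ// mulN1r. Qed.

Lemma functional_sum f (I : finType) (F : I -> J) : functional f ->
  f (\sum_i F i) = \sum_i f (F i).
Proof.
move=> ff; elim/big_rec2: _ => [|i y1 y2 _ <-]; first exact: functional0.
exact: functionalD.
Qed.

(** Induction on [a]. For [b] close below [a], the truncation at [a] is the truncation at [b] plus
    val x a times the indicator of ]b, a], up to a small error; [f] kills the truncation at [b] by
    induction. *)
Lemma functional_top f a x : functional f -> (forall b, (b < a)%O -> f (indJ b) = 0) ->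
  f (trunc x a) = val x a * f (indJ a).
Proof.
move=> ff; elim/(omega1_ind hW): a x => a ih x fa.
rewrite -functionalZ//.
have [[v va]|a0] := pselect (exists v, (v < a)%O); last first.
  congr f; apply: val_inj; apply/funext => t; rewrite valJZ truncE /= /ind.
  case: leP => [|_]; last by rewrite mulr0.
  rewrite le_eqVlt => /predU1P[->|ta]; first by rewrite mulr1.
  by exfalso; apply: a0; exists t.
have [_ [m m0 fm]] := ff.
apply/eqP; rewrite -subr_eq0; apply/eqP/eq0_normc/eqP.
rewrite eq_le normc_ge0 andbT; apply/ler_addgt0Pl => e e0; rewrite addr0.
(* Chosen so that m * (3 * h) <= e, also when m = 0; the factor 3 comes from [pvar_le_peak], as 3
   h^p <= (3 h)^p. *)
pose h := e / (3 * (m + 1)).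
have h0 : 0 < h by rewrite divr_gt0// mulr_gt0// ltr_wpDl.
have [b ba bP] := pvar_le_peak x va h0.
rewrite -functionalB//.
(* The terms at [b] are invisible to [f] and cut the difference down to the window ]b, a]. *)
pose z : J := trunc x a - val x a *: indJ a - (trunc x b - val x a *: indJ b).
have zE : val z = (fun t => if (b < t <= a)%O then val x t - val x a else 0).
  apply/funext => t; rewrite /z !valJB !valJZ !truncE /= /ind.
  case: (leP t a) => ta; last first.
    by rewrite andbF leNgt (lt_trans ba ta) /= !mulr0 !subrr.
  rewrite mulr1; case: leP => tb /=; first by rewrite mulr1 subrr.
  by rewrite mulr0 !subr0.
have -> : f (trunc x a - val x a *: indJ a) = f z.
  rewrite [RHS]functionalB// -[LHS]subr0; congr (_ - _).
  rewrite functionalB// functionalZ// (fa _ ba) ih//; last first.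
    by move=> c cb; apply: fa; exact: lt_trans ba.
  by rewrite (fa _ ba) !mulr0 subrr.
have nz : nrm z <= 3 * h.
  apply: (powR_le_inv p1 (nrm_ge0 _)); first by rewrite mulr_ge0// ltW.
  apply: (@le_trans _ _ (3 * h `^ p)); first by apply: nrm_le_pvar; rewrite zE.
  rewrite (powRM p (ler0n R 3) (ltW h0)) ler_wpM2r ?powR_ge0// -[leLHS]powRr1//.
  by apply: ler_powR; [rewrite ler1n|exact: ltW].
apply: le_trans (fm z) _; apply: le_trans (ler_wpM2l m0 nz) _.
have -> : m * (3 * h) = e * (m / (m + 1)).
  by rewrite /h; field; rewrite gt_eqF// ltr_wpDl.
by rewrite ler_piMr ?(ltW e0)// ler_pdivrMr ?mul1r ?lerDl// ltr_wpDl.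
Qed.

End Functionals.

(** * The diagonal of an operator *)

Section Diagonal.
Context {R : realType} {p : R} (p1 : 1 < p).
Context {d : Order.disp_t} {W : orderTopologicalType d} (hW : is_omega1 W).
Local Notation J := (james p1 hW).
Implicit Types (x y : J) (a b t : W).

Let p0 : 0 < p. Proof. exact: lt_trans p1. Qed.

(** Here p > 1 is decisive: n^p outgrows every multiple of n. The threshold [u] solves u^(p - 1) =
    |K| + 1. *)
Lemma powR_p_unbounded (K : R) : exists n : nat, K * n%:R < n%:R `^ p.
Proof.
pose u := (`|K| + 1) `^ (p - 1)^-1.
have q0 : 0 < p - 1 by rewrite subr_gt0.
have k0 : 0 < `|K| + 1 by rewrite ltr_wpDl.
have [n un] : exists n : nat, u < n%:R.
  by exists (Num.truncn u).+1; exact: truncnS_gt.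
have u0 : 0 < u by exact: powR_gt0.
have n0 : 0 < n%:R :> R by exact: lt_trans un.
exists n.
have -> : p = (p - 1) + 1 by rewrite subrK.
rewrite powRD; last by rewrite (gt_eqF n0) implybT.
rewrite powRr1 ?(ltW n0)// ltr_pM2r//.
apply: le_lt_trans (ler_norm K) _; apply: lt_trans (_ : _ < `|K| + 1) _; first by rewrite ltrDl.
have -> : `|K| + 1 = u `^ (p - 1).
  by rewrite /u -powRrM mulVf ?powRr1 ?(ltW k0)// gt_eqF.
by apply: gt0_ltr_powR; rewrite ?nnegrE ?(ltW u0) ?(ltW n0).
Qed.

(* Otherwise successive disjointly supported x_i with f x_i = 1 and bounded
   norms have sums of norm O(n ^ (1 / p)) on which f takes the value n. *)
Lemma functional_tail_small (f : J -> R[i]) (e : R) : functional f -> 0 < e ->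
  exists g : W, forall x, (forall t, (t <= g)%O -> val x t = 0) -> normc (f x) <= e * nrm x.
Proof.
move=> ff e0; apply: contrapT => nog.
have H g : exists x : J, [/\ forall t, (t <= g)%O -> val x t = 0, f x = 1 & nrm x <= e^-1].
  apply: contrapT => nox; apply: nog; exists g => x xg; rewrite leNgt; apply/negP => lt.
  have fx0 : 0 < normc (f x) by apply: le_lt_trans lt; rewrite mulr_ge0 ?nrm_ge0// ltW.
  have fx : f x != 0 by apply: contraTneq fx0 => ->; rewrite /normc /= expr0n addr0 sqrtr0 ltxx.
  apply: nox; exists ((f x)^-1 *: x); split.
  - by move=> t tg; rewrite valJZ xg ?mulr0.
  - by rewrite functionalZ// mulVf.
  - by rewrite nrmZ normcV ler_pdivrMl// ler_pdivlMr// mulrC ltW.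
have [X XP] := choice H.
have [B BP] : exists B : W -> W, forall g t, (B g <= t)%O -> val (X g) t = 0.
  by have [B BP] := choice (fun g => james_support (X g)); exists B.
have [w0] := is_omega1_nonempty hW.
(* Each cut lies beyond the support of the previous function, so [X (g i)] lives between [g i] and
   [g i.+1]. *)
pose g n := iter n (fun b => Order.max b (B b)) w0.
have gmono m n : (m <= n)%N -> (g m <= g n)%O.
  by apply: (homo_leq (@le_refl _ W) (@le_trans _ W)) => i; rewrite /g iterS le_max lexx.
have disj i j t : (i < j)%N -> val (X (g i)) t = 0 \/ val (X (g j)) t = 0.
  move=> ij; have [tg|gt] := leP t (g j); first by right; have [->] := XP (g j).
  left; apply: BP; apply: le_trans (ltW gt); apply: le_trans (gmono _ _ ij).
  by rewrite /g iterS le_max lexx orbT.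
have [_ [m m0 fm]] := ff.
(* For the sum y below, n^p = |f y|^p is at most m^p times the p-th power of its norm, which in turn
   is at most 2^p e^(-p) n. *)
have [n] := powR_p_unbounded (m `^ p * (2 `^ p * e^-1 `^ p)).
apply/negP; rewrite -leNgt.
pose y : J := \sum_(i < n) X (g i).
have fy : f y = n%:R.
  rewrite functional_sum// (eq_bigr (fun=> 1)) => [|i _]; last by have [] := XP (g i).
  by rewrite sumr_const card_ord.
have ny : nrm y `^ p <= 2 `^ p * (e^-1 `^ p * n%:R).
  have -> : e^-1 `^ p * n%:R = \sum_(i < n) e^-1 `^ p by rewrite sumr_const card_ord mulr_natr.
  apply: nrm_le_pvar.
  have -> : val y = (fun t => \sum_(i < n) val (X (g i)) t).
    by apply/funext => t; exact: valJ_sum.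
  apply: (pvar_le_sum p1) => [i j t|i].
    rewrite neq_ltn => /orP[ij|ij]; first exact: disj.
    by have [->|->] := disj j i t ij; [right|left].
  apply: (@pvar_le_weak _ p _ _ _ (nrm (X (g i)) `^ p)); first exact: james_pvar.
  by apply: (ler_powR2 p1 (nrm_ge0 _)); have [] := XP (g i).
have nn : normc (n%:R : R[i]) = n%:R.
  by rewrite normcMn normc1.
have := fm y; rewrite fy nn => /(ler_powR2 p1 (ler0n _ _)) le1.
apply: (le_trans le1); rewrite powRM ?nrm_ge0// -!mulrA ler_wpM2l ?powR_ge0//.
Qed.

Lemma functional_tail (f : J -> R[i]) : functional f ->
  exists g : W, forall x, (forall t, (t <= g)%O -> val x t = 0) -> f x = 0.
Proof.
move=> ff.
have H (n : nat) : exists g, forall x, (forall t, (t <= g)%O -> val x t = 0) ->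
    normc (f x) <= n.+1%:R^-1 * nrm x.
  by apply: functional_tail_small => //; rewrite invr_gt0.
have [G GP] := choice H; have [g gP] := omega1_seq_ub hW G.
exists g => x xg; apply/eq0_normc/eqP; rewrite eq_le normc_ge0 andbT.
apply/ler_addgt0Pl => e e0; rewrite addr0.
have [n ne] : exists n, n.+1%:R^-1 < e / (nrm x + 1).
  have ex0 : 0 < e / (nrm x + 1) by rewrite divr_gt0// ltr_wpDl// nrm_ge0.
  have [n _ nP] := near_infty_natSinv_lt (PosNum ex0); exists n; exact: (nP n (leqnn n)).
apply: (le_trans (GP n x _)) => [t tG|].
  by apply: xg; apply: le_trans tG (ltW (gP n)).
apply: (le_trans (ler_wpM2r (nrm_ge0 _) (ltW ne))).
rewrite mulrAC ler_pdivrMr ?ltr_wpDl ?nrm_ge0// ler_pM2l// lerDl.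
exact: ler01.
Qed.

Local Notation B := (bounded_op J).

Lemma op_linear (T : B) (c : R[i]) x y : val T (c *: x + y) = c *: val T x + val T y.
Proof. by have := valP T; rewrite inE => -[Tl _]; exact: Tl. Qed.

Lemma op_bound (T : B) : exists2 m : R, 0 <= m & forall x, nrm (val T x) <= m * nrm x.
Proof.
have := valP T; rewrite inE => -[_ [M TM]].
exists (normc M) => [|x]; first exact: normc_ge0.
have := TM x; rewrite !normE => h.
have h0 : 0 <= M * (nrm x)%:C%C by apply: le_trans h; rewrite lecR nrm_ge0.
rewrite -lecR; apply: (le_trans h).
rewrite -(ger0_norm h0) normrM rmorphM /= ler_wpM2l//.
by rewrite ger0_norm// lecR nrm_ge0.
Qed.

Lemma op_functional (T : B) t : functional (fun x => val (val T x) t).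
Proof.
split=> [c x y|]; first by rewrite op_linear valJD valJZ.
have [m m0 Tm] := op_bound T; exists m => // x.
exact: le_trans (james_eval _ _) (Tm x).
Qed.

Definition diagonal_on (T : B) (l : R[i]) (s : W -> W) : Prop :=
  forall a, club s a -> forall x, val (val T x) a = l * val x a.

(** At a suitable limit [a], the functional x |-> (T x)(a) kills the indicators of [0, b] for b < a,
    so [functional_top] evaluates it on the part of x up to [a]. For the part of x beyond [a], the
    image vanishes below [a] and hence, by continuity, at [a]. This leaves (T x)(a) = mu(a) x(a),
    where mu(a) is the value at [a] of the image of the indicator of [0, a]. *)
Lemma op_diagonal (T : B) : exists l s, diagonal_on T l s.
Proof.
have [S SP] : exists S : W -> W, forall b t, (S b <= t)%O -> val (val T (indJ p1 hW b)) t = 0.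
  by have [S SP] := choice (fun b => james_support (val T (indJ p1 hW b))); exists S.
have [G GP] := choice (fun b => functional_tail (op_functional T b)).
have [N NP] := choice (omega1_succ hW).
(* From [S b] on, the image of the indicator of [0, b] is zero; the value of T x at [b] depends only
   on x up to [G b]; and [N b] makes every club point a limit. *)
pose s b := Order.max (S b) (Order.max (G b) (N b)).
pose mu a := val (val T (indJ p1 hW a)) a.
have diag a x : club s a -> val (val T x) a = mu a * val x a.
  move=> [a0 aP].
  have sP b : (b < a)%O -> [/\ (S b < a)%O, (G b < a)%O & (N b < a)%O].
    by move=> /aP; rewrite !gt_max => /and3P[].
  have ff := op_functional T a.
  have top : val (val T (trunc x a)) a = val x a * mu a.
    apply: (functional_top x ff) => b /sP[Sb _ _]; apply: SP; exact: ltW.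
  have tail : val (val T (x - trunc x a)) a = 0.
    set y := val T _.
    have y0 b : (b < a)%O -> val y b = 0.
      move=> /sP[_ Gb _]; apply: GP => t tG.
      by rewrite valJB truncE (le_trans tG (ltW Gb)) subrr.
    apply/eq0_normc/eqP; rewrite eq_le normc_ge0 andbT.
    apply/ler_addgt0Pl => e e0; rewrite addr0.
    have [v va vP] := @james_left_cont _ _ p1 _ _ hW y a e a0 e0.
    have [_ _ Nv] := sP v va.
    by have := vP (N v); rewrite NP Nv y0// sub0r normcN => /(_ isT)/ltW.
  rewrite -[in LHS](subrK (trunc x a) x) (functionalD _ _ ff).
  by rewrite tail top add0r mulrC.
have [m m0 Tm] := op_bound T.
(* The values of [mu] along a finite chain of club points can all be read off from the image of a
   single indicator. So [mu] has bounded p-variation along the club and is eventually constant. *)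
pose nu t : R[i]^o := mu (club_next hW s t).
have nuE a b : (a <= b)%O ->
    nu a = val (val T (indJ p1 hW (club_next hW s b))) (club_next hW s a).
  move=> ab; rewrite diag; last exact: club_nextP.
  by rewrite /= /ind club_next_mono// mulr1.
have nu_var : pvar_le p nu (m `^ p).
  apply: (pvar_leP p1) => n a an.
  pose z := val T (indJ p1 hW (club_next hW s (a n))).
  have an_le i : (i <= n)%N -> (a i <= a n)%O.
    by move=> iN; apply: (chain_le an); rewrite iN leqnn.
  have -> : pvar_sum p nu n a = pvar_sum p (val z \o club_next hW s) n a.
    by apply: eq_bigr => i _; rewrite !(nuE _ (a n)) ?an_le// ltnW.
  apply: (pvar_sum_le _ an).
  apply: (@pvar_le_weak _ p _ _ _ (nrm z `^ p)).
    by apply: pvar_le_comp; [exact: club_next_mono|exact: james_pvar].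
  apply: (ler_powR2 p1 (nrm_ge0 _)); apply: le_trans (Tm _) _.
  rewrite ler_piMr//; apply: (powR_le_inv p1 (nrm_ge0 _) ler01).
  by rewrite powR1; apply: nrm_le_pvar; exact: pvar_le_ind.
have [b bP] := pvar_le_eventually_cst p1 hW nu_var.
(* The maximum with the constant [b] keeps only the club points beyond [b]. *)
exists (nu b), (fun t => Order.max (s t) b) => a ca x.
have [[c0 c0a] cb] := club_maxr (s' := fun=> b) ca.
have sa : club s a by exact: (club_maxl (s' := fun=> b) ca).
by rewrite diag// -(bP a (ltW (cb _ c0a))) /nu club_next_id.
Qed.

End Diagonal.

(** * Operators attached to a club *)

Section Operators.
Context {R : realType} {p : R} (p1 : 1 < p).
Context {d : Order.disp_t} {W : orderTopologicalType d} (hW : is_omega1 W).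
Local Notation J := (james p1 hW).
Local Notation B := (bounded_op J).
Implicit Types (x y : J) (a b t : W).

Let p0 : 0 < p. Proof. exact: lt_trans p1. Qed.

Let normc00 : normc 0 = 0 :> R.
Proof. by rewrite /normc /= expr0n addr0 sqrtr0. Qed.

Lemma op_exists (F : J -> W -> R[i]^o) (m : R) :
  (forall (c : R[i]) x y t, F (c *: x + y) t = c * F x t + F y t) ->
  (forall x, F x \in in_james p1 hW) -> 0 <= m ->
  (forall x, pvar_le p (F x) (m * nrm x `^ p)) ->
  exists T : B, forall x t, val (val T x) t = F x t.
Proof.
move=> Fl FJ m0 Fm; pose G x : J := toJ (FJ x).
have Gb : (G : J -> J) \in @bounded_linear R[i] J.
  rewrite inE; split=> [c x y|]; first by apply: val_inj; apply/funext => t; exact: Fl.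
  exists ((m `^ p^-1)%:C)%C => x; rewrite !normE -rmorphM lecR /=.
  apply: (powR_le_inv p1 (nrm_ge0 _)); first by rewrite mulr_ge0 ?powR_ge0 ?nrm_ge0.
  rewrite powRM ?powR_ge0 ?nrm_ge0// -powRrM mulVf ?gt_eqF// powRr1//.
  by apply: nrm_le_pvar; exact: Fm.
by exists (Sub G Gb).
Qed.

(** The suprema in the norms are taken one index at a time, so it is enough to bound the sums over
    independently chosen chains. *)
Lemma nrm_sum_le (z : nat -> J) (N : nat) (K : R) :
  (forall (k : nat -> nat) (u : nat -> nat -> W), (forall n, (n < N)%N -> chain (k n) (u n)) ->
    \sum_(n < N) pvar_sum p (val (z n)) (k n) (u n) <= K) ->
  \sum_(n < N) nrm (z n) `^ p <= K.
Proof.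
elim: N K => [|N ih] K zK.
  have [w0] := is_omega1_nonempty hW.
  by have := zK (fun=> 0%N) (fun=> fun=> w0); rewrite !big_ord0; apply.
rewrite big_ord_recr /= addrC -lerBrDr; apply: nrm_le_pvar; apply: (pvar_leP p1) => k' u' ku'.
rewrite lerBrDr addrC -lerBrDr; apply: ih => k u ku; rewrite lerBrDr.
have := zK (fun n => if (n < N)%N then k n else k') (fun n => if (n < N)%N then u n else u') _.
rewrite big_ord_recr /= ltnn; under eq_bigr do rewrite ltn_ord.
by apply=> n nN; case: ifP => // nN'; exact: ku.
Qed.

(** * Composition with the next point of a club *)

Section Next.
Context (s : W -> W).
Local Notation c := (club_next hW s).

Lemma club_next_gap w u : (u < w)%O -> c u = c w \/ (c u < w)%O.
Proof.
move=> uw; have [wu|] := leP w (c u); last by right.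
by left; rewrite -(@club_next_between _ _ hW s u w)// ltW.
Qed.

Lemma club_next_limit w : (forall v, (v < w)%O -> exists u, (v < u < w)%O) ->
  (exists v, (v < w)%O) -> (forall u, (u < w)%O -> (c u < w)%O) -> club s w.
Proof.
move=> lim w0 wP; apply: club_closed => // b /lim[u /andP[bu uw]].
exists (c u); first exact: club_nextP.
by rewrite (lt_le_trans bu (club_next_ge _ _ _))/= ltW// wP.
Qed.

(** A nondecreasing substitution does not increase p-variation; only continuity at a limit [w] is in
    question. Either the gap of [w] begins below [w] and the composite is constant there, or [w] is
    a limit of club points, hence in the club, and continuity of [x] at [w] applies. *)
Lemma exists_next : exists T : B, forall x t, val (val T x) t = val x (c t).
Proof.
apply: (@op_exists (fun x t => val x (c t)) 1) => //.
- move=> x.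
  have xv : pvar_le p (fun t => val x (c t)) (nrm x `^ p).
    by apply: (pvar_le_comp (x := val x)); [exact: club_next_mono|exact: james_pvar].
  have [a aP] := james_support x.
  apply: (james_intro p1 hW (a := a) _ _ xv); last first.
    by move=> t at_; apply: aP; apply: le_trans (club_next_ge _ _ _).
  apply: (left_cont_frequently p1 xv) => w v e vw e0 lim.
  have [[u [vu uw cu]]|nou] := pselect (exists u, [/\ (v < u)%O, (u < w)%O & c u = c w]).
    by exists u; rewrite ?vu// cu subrr normc00.
  have cw u : (u < w)%O -> (c u < w)%O.
    move=> uw; have [u' /andP[]] := lim (Order.max u v) ltac:(by rewrite gt_max uw).
    rewrite gt_max => /andP[uu' vu'] u'w.
    have [cu'|] := club_next_gap u'w; first by exfalso; apply: nou; exists u'.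
    by apply: le_lt_trans; apply/club_next_mono/ltW.
  have sw := club_next_limit lim (ex_intro _ v vw) cw.
  have [r rw rP] := @james_left_cont _ _ p1 _ _ hW x w e (ex_intro _ v vw) e0.
  have [u /andP[]] := lim (Order.max r v) ltac:(by rewrite gt_max rw).
  rewrite gt_max => /andP[ru vu] uw; exists u; rewrite ?vu// (club_next_id hW sw).
  by apply: rP; rewrite cw// andbT; apply: lt_le_trans ru (club_next_ge _ _ _).
- move=> x; rewrite mul1r.
  by apply: (pvar_le_comp (x := val x)); [exact: club_next_mono|exact: james_pvar].
Qed.

(** * Extracting a sequence of functions from the blocks *)

Context (h : W -> nat -> W -> W) (co : W -> W * nat * W).
Hypothesis (co_le : forall w, ((co w).2 <= (co w).1.1)%O)
  (coK : forall w, h (co w).1.1 (co w).1.2 (co w).2 = w)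
  (hK : forall b n t, (t <= b)%O -> co (h b n t) = (b, n, t))
  (co_lt : forall u v, (u < v)%O <-> block_lt (co u) (co v)).

Lemma h_lt b n t b' n' t' : (t <= b)%O -> (t' <= b')%O ->
  (h b n t < h b' n' t')%O <-> block_lt (b, n, t) (b', n', t').
Proof. by move=> tb tb'; rewrite co_lt !hK. Qed.

Lemma h_le b n t t' : (t' <= b)%O -> (t <= t')%O -> (h b n t <= h b n t')%O.
Proof.
move=> tb; rewrite le_eqVlt => /predU1P[->//|tt]; apply: ltW.
by apply/h_lt; [exact: le_trans (ltW tt) tb|exact: tb|right; split => //; right].
Qed.

Lemma hP w : exists b n t, (t <= b)%O /\ w = h b n t.
Proof. by exists (co w).1.1, (co w).1.2, (co w).2; split. Qed.

(** Left continuity of the embedding of [0, b] as a block. The point [v] keeps [w] away from the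
    first point of the block, where earlier blocks would intervene. *)
Lemma h_limit_lt b n w v u : (w <= b)%O -> (v < w)%O -> (u < h b n w)%O ->
  exists2 r, (r < w)%O & forall t, (r < t < w)%O -> (u < h b n t)%O.
Proof.
move=> wb vw; have [b' [n' [t' [tb' ->]]]] := hP u.
move=> /(h_lt _ _ tb' wb) bl.
case: bl => [/= bb|[/= bb [nn|[nn tt]]]].
- exists v => // t /andP[_ tw]; apply/h_lt => //; first exact: le_trans (ltW tw) wb.
  by left.
- exists v => // t /andP[_ tw]; apply/h_lt => //; first exact: le_trans (ltW tw) wb.
  by right; split => //; left.
- exists t' => // t /andP[tt' tw]; apply/h_lt => //; first exact: le_trans (ltW tw) wb.
  by right; split => //; right.
Qed.

(** The n-th copy: the gap that ends at the club point [c t] is put into the block (c t, n), at its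
    own position in [0, c t]. *)
Definition emb n t := h (c t) n t.

Lemma emb_lt n t t' : (t < t')%O -> (emb n t < emb n t')%O.
Proof.
move=> tt'; apply/h_lt; rewrite ?club_next_ge//.
have := club_next_mono hW s (ltW tt'); rewrite le_eqVlt => /predU1P[->|?]; last by left.
by right; split => //; right.
Qed.

Lemma emb_le n t t' : (t <= t')%O -> (emb n t <= emb n t')%O.
Proof. by rewrite le_eqVlt => /predU1P[->//|/emb_lt/ltW]. Qed.

Lemma next_next t : c (c t) = c t.
Proof. exact/club_next_id/club_nextP. Qed.

(** Since [emb n] jumps at limits of club points, composing with it alone would not preserve
    continuity. Subtracting the value at the end of the gap yields zeros on the club, and changes
    nothing on functions that already vanish at these ends. *)
Definition unblock n x t : R[i]^o := val x (emb n t) - val x (emb n (c t)).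

Lemma unblock_pvar n x : pvar_le p (unblock n x) (2 `^ p * (nrm x `^ p + nrm x `^ p)).
Proof.
apply: (pvar_leB p1) => //.
  by apply: (pvar_le_comp (x := val x) (f := emb n)); [exact: emb_le|exact: james_pvar].
apply: (pvar_le_comp (x := val x) (f := fun t => emb n (c t))); last exact: james_pvar.
by move=> t t' tt'; apply/emb_le/club_next_mono.
Qed.

Lemma unblock_club n x a : club s a -> unblock n x a = 0.
Proof. by move=> sa; rewrite /unblock club_next_id// subrr. Qed.

(** If the gap of a limit [w] begins below [w], the subtracted term is constant near [w] and
    continuity of [x] at [emb n w] is enough. Otherwise [w] is in the club, and the club points
    below [w], where the function is zero, come arbitrarily close to it. *)
Lemma unblock_left_cont n x : left_cont (unblock n x).
Proof.
apply: (left_cont_frequently p1 (unblock_pvar n x)) => w v e vw e0 lim.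
have [[u0 [vu0 u0w cu0]]|nou] := pselect (exists u, [/\ (v < u)%O, (u < w)%O & c u = c w]); last first.
  have cw u : (u < w)%O -> (c u < w)%O.
    move=> uw; have [u' /andP[]] := lim (Order.max u v) ltac:(by rewrite gt_max uw).
    rewrite gt_max => /andP[uu' vu'] u'w.
    have [cu'|] := club_next_gap u'w; first by exfalso; apply: nou; exists u'.
    by apply: le_lt_trans; apply/club_next_mono/ltW.
  have sw := club_next_limit lim (ex_intro _ v vw) cw.
  have [u /andP[vu uw]] := lim v vw.
  exists (c u); first by rewrite cw// andbT (lt_le_trans vu)// club_next_ge.
  by rewrite !unblock_club ?subrr ?normc00//; exact: club_nextP.
have lt0 : (emb n u0 < emb n w)%O by exact: emb_lt.
have [r rw rP] := @james_left_cont _ _ p1 _ _ hW x (emb n w) e (ex_intro (fun v => (v < emb n w)%O) _ lt0) e0.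
have [r' r'w r'P] := h_limit_lt (club_next_ge hW s w) u0w rw.
have [u /andP[]] := lim (Order.max r' u0) ltac:(by rewrite gt_max r'w).
rewrite gt_max => /andP[r'u u0u] uw.
have cu : c u = c w by rewrite (@club_next_between _ _ hW s u0) ?(ltW u0u)// cu0 (le_trans (ltW uw) (club_next_ge _ _ _)).
exists u; first by rewrite (lt_trans vu0 u0u).
rewrite /unblock cu.
have -> : forall A D E : R[i], A - D - (E - D) = A - E by move=> *; ring.
by apply: rP; rewrite emb_lt// andbT {1}/emb cu; apply: r'P; rewrite r'u.
Qed.

Lemma exists_unblock n : exists T : B, forall x t, val (val T x) t = unblock n x t.
Proof.
apply: (@op_exists (unblock n) (2 `^ p * 2)).
- by move=> b x y t; rewrite /unblock !valJD !valJZ; ring.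
- move=> x; have [a aP] := james_support x.
  have [a' aa'] := omega1_succ hW (co a).1.1.
  apply: (james_intro p1 hW (a := a') _ _ (unblock_pvar n x)); first exact: unblock_left_cont.
  have far t : (a' <= t)%O -> val x (emb n t) = 0.
    move=> at_; apply: aP; apply: ltW; apply/co_lt; rewrite hK ?club_next_ge//.
    by left; apply: lt_le_trans aa' (le_trans at_ (club_next_ge _ _ _)).
  move=> t at_; rewrite /unblock !far ?subrr//.
  exact: le_trans at_ (club_next_ge _ _ _).
- by rewrite mulr_ge0// powR_ge0.
- move=> x; rewrite -mulrA mulrDl mul1r; exact: unblock_pvar.
Qed.


(* The order type of the blocks, so that finitely many of them can be sorted. *)
Local Notation blocks := (W *l nat)%type.

(** Distinct blocks are disjoint intervals; once they are sorted, the increments of the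
    nondecreasing [Om] over them telescope. *)
Lemma blocks_disjoint x Om (M : R) (L : seq blocks) (w0 : W) : (forall t, (w0 <= t)%O) ->
  controls p (val x) Om -> (forall a b, Om b - Om a <= M) -> uniq L ->
  \sum_(q <- L) (Om (h q.1 q.2 q.1) - Om (h q.1 q.2 w0)) <= M.
Proof.
move=> w0P xO OM uL.
have Omh a b : (a <= b)%O -> Om a <= Om b.
  by move=> /xO ab; rewrite -subr_ge0; apply: le_trans ab; exact: powR_ge0.
have M0 : 0 <= M by have := OM w0 w0; rewrite subrr.
rewrite -(perm_big _ (permEl (perm_sort <=%O L))) /=.
have : sorted <%O (sort <=%O L) by rewrite sort_lt_sorted.
case: (sort _ _) => [|q l] /=; first by rewrite big_nil.
move=> ql; apply: le_trans (OM (h q.1 q.2 w0) (h (last q l).1 (last q l).2 (last q l).1)).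
elim: l q ql => [|q' l ih] q /=; first by rewrite big_seq1.
move=> /andP[qq' ql]; rewrite big_cons; apply: le_trans (lerD (lexx _) (ih q' ql)) _.
have /Omh : (h q.1 q.2 q.1 <= h q'.1 q'.2 w0)%O.
  apply/ltW/h_lt; rewrite ?w0P//.
  case: q q' qq' {ql} => [b n] [b' n']; rewrite ltxi_pair /= => /andP[].
  rewrite le_eqVlt => /predU1P[->|?]; last by left.
  by rewrite lexx /= => nn; right; split => //; left.
rewrite -subr_ge0 => le.
rewrite -subr_ge0; apply: le_trans le _; rewrite -subr_ge0.
by rewrite le_eqVlt; apply/orP; left; apply/eqP; ring.
Qed.

(** [L] lists the gaps that the chain has left, and [D q] is the growth of [Om] over the whole block
    (q, n). A block left behind is charged twice: once for the increment that enters it, once for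
    the increments inside it and the one that leaves it. The block in progress is charged for its
    entry and for the part already traversed. *)
Lemma unblock_chain x Om n k (u : nat -> W) (w0 : W) : (forall t, (w0 <= t)%O) ->
  controls p (val x) Om -> chain k u ->
  exists L : seq W, [/\ uniq L, forall q, q \in L -> (q < c (u k))%O &
    let D q := Om (h q n q) - Om (h q n w0) in
    pvar_sum p (unblock n x) k u <=
    2 `^ p * (2 * (\sum_(q <- L) D q) + D (c (u k)) + (Om (emb n (u k)) - Om (h (c (u k)) n w0)))].
Proof.
move=> w0P xO; pose D q := Om (h q n q) - Om (h q n w0).
have Omh a b : (a <= b)%O -> Om a <= Om b.
  by move=> /xO ab; rewrite -subr_ge0; apply: le_trans ab; exact: powR_ge0.
have D0 q : 0 <= D q by rewrite subr_ge0 Omh// h_le.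
have E0 t : 0 <= Om (emb n t) - Om (h (c t) n w0).
  by rewrite subr_ge0 Omh// h_le// club_next_ge.
have T0 : 0 <= 2 `^ p :> R by exact: powR_ge0.
have T1 : 1 <= 2 `^ p :> R.
  rewrite -[leLHS](powRr0 2); apply: ler_powR; last exact: ltW.
  by rewrite ler1n.
have Vle t : normc (unblock n x t) `^ p <= Om (h (c t) n (c t)) - Om (emb n t).
  rewrite /unblock normc_distC.
  have -> : emb n (c t) = h (c t) n (c t) by rewrite /emb next_next.
  by apply: xO; rewrite h_le// club_next_ge.
elim: k => [|k ih] uk.
  exists [::]; split => [//|//|].
  rewrite /pvar_sum big_ord0 big_nil mulr0 add0r.
  rewrite mulr_ge0// addr_ge0//. exact: D0.
have [L [uL Lk /= le]] := ih (fun i ik => uk i (ltnW ik)).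
have uku : (u k <= u k.+1)%O by apply/ltW/uk.
rewrite /pvar_sum big_ord_recr /= -/(pvar_sum p (unblock n x) k u).
have [cc|cc] := eqVneq (c (u k)) (c (u k.+1)).
  exists L; split => //; first by rewrite -cc.
  have inc : normc (unblock n x (u k.+1) - unblock n x (u k)) `^ p <=
      Om (emb n (u k.+1)) - Om (emb n (u k)).
    rewrite /unblock cc.
    have -> : forall A E F : R[i], A - F - (E - F) = A - E by move=> *; ring.
    by apply: xO; exact: emb_le.
  have inc' : normc (unblock n x (u k.+1) - unblock n x (u k)) `^ p <=
      2 `^ p * (Om (emb n (u k.+1)) - Om (emb n (u k))).
    apply: (le_trans inc); rewrite ler_peMl// subr_ge0.
    exact/Omh/emb_le.
  apply: le_trans (lerD le inc') _; rewrite -mulrDr ler_wpM2l// -cc.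
  by rewrite le_eqVlt; apply/orP; left; apply/eqP; ring.
have clt : (c (u k) < c (u k.+1))%O by rewrite lt_neqAle cc club_next_mono.
exists (c (u k) :: L); split.
- by rewrite /= uL andbT; apply/negP => /Lk; rewrite ltxx.
- move=> q; rewrite inE => /predU1P[->//|/Lk qk]; exact: lt_trans clt.
rewrite big_cons.
have inc : normc (unblock n x (u k.+1) - unblock n x (u k)) `^ p <=
    2 `^ p * (D (c (u k.+1)) + (Om (h (c (u k)) n (c (u k))) - Om (emb n (u k)))).
  apply: (le_trans (ler_powR2 p1 (normc_ge0 _) (le_normcD _ _))).
  apply: (le_trans (powR_leD p1 (normc_ge0 _) (normc_ge0 _))).
  rewrite normcN ler_wpM2l//; apply: lerD; last exact: Vle.
  apply: le_trans (Vle _) _; rewrite lerB// Omh// h_le// club_next_ge.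
  by [].
apply: le_trans (lerD le inc) _; rewrite -mulrDr ler_wpM2l//.
rewrite -/(D (c (u k))) -/(D (c (u k.+1))) -subr_ge0.
have := E0 (u k.+1); congr (is_true (_ <= _)); rewrite /D; ring.
Qed.


(** Extraction is bounded into the l^p-sum: chains in different copies charge different blocks, and
    within a copy each block is charged at most twice, once the block in progress is counted as
    finished. *)
Lemma unblock_sum x N (z : nat -> J) : (forall n t, val (z n) t = unblock n x t) ->
  \sum_(n < N) nrm (z n) `^ p <= 2 `^ p * (2 * nrm x `^ p).
Proof.
move=> zE; apply: nrm_sum_le => k u ku.
have [w00] := is_omega1_nonempty hW.
have [w0 _ w0P'] := omega1_min hW (A := setT) (ex_intro _ w00 I).
have w0P t : (w0 <= t)%O by exact: w0P'.
have [Om xO OM] := james_pvar x.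
have Omh a b : (a <= b)%O -> Om a <= Om b.
  by move=> /xO ab; rewrite -subr_ge0; apply: le_trans ab; exact: powR_ge0.
have H n : exists L : seq W, uniq L /\ ((n < N)%N -> pvar_sum p (val (z n)) (k n) (u n) <=
    2 `^ p * (2 * \sum_(q <- L) (Om (h q n q) - Om (h q n w0)))).
  have [nN|_] := boolP (n < N)%N; last by exists [::].
  have [L [uL Ll le]] := unblock_chain n w0P xO (ku n nN).
  exists (c (u n (k n)) :: L); split.
    by rewrite /= uL andbT; apply/negP => /Ll; rewrite ltxx.
  move=> _; have -> : val (z n) = unblock n x by apply/funext => t; exact: zE.
  apply: (le_trans le); rewrite ler_wpM2l ?powR_ge0// big_cons -subr_ge0.
  have : 0 <= Om (h (c (u n (k n))) n (c (u n (k n)))) - Om (emb n (u n (k n))).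
    by rewrite subr_ge0 Omh// h_le// club_next_ge.
  congr (is_true (_ <= _)); ring.
have [L LP] := choice H.
pose LL : seq blocks := [seq (q, n) | n <- iota 0 N, q <- L n].
have uLL : uniq LL.
  apply: allpairs_uniq_dep => [|n _|]; [exact: iota_uniq|exact: (LP n).1|].
  by move=> [n q] [n' q'] _ _ /= [-> ->].
apply: le_trans (_ : 2 `^ p * (2 * \sum_(q <- LL) (Om (h q.1 q.2 q.1) - Om (h q.1 q.2 w0))) <= _); last first.
  by rewrite !ler_wpM2l ?powR_ge0//; exact: blocks_disjoint xO OM uLL.
have iotaE : iota 0 N = index_iota 0 N by rewrite /index_iota subn0.
rewrite /LL big_allpairs_dep /= !mulr_sumr iotaE big_mkord.
by apply: ler_sum => n _; apply: (LP n).2.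
Qed.


(** * Placing a sequence of functions into the blocks *)

Definition layer n x w : R[i]^o :=
  if ((co w).1.2 == n) && (c (co w).2 == (co w).1.1) then val x (co w).2 else 0.

(** [layer n x] is [x] transported along [emb n] and extended by zero; the test in its definition
    recognises the range of [emb n]. *)
Lemma layer_emb n x t : layer n x (emb n t) = val x t.
Proof. by rewrite /layer /emb hK ?club_next_ge//= !eqxx. Qed.

Lemma layerP n x w : (exists t, w = emb n t) \/
  ((forall t, w <> emb n t) /\ layer n x w = 0).
Proof.
have [[b [m [t [tb ->]]]]] := (hP w, tt).
have [/andP[/eqP mn /eqP cb]|no] := boolP ((m == n) && (c t == b)).
  by left; exists t; rewrite /emb mn cb.
right; split=> [t'|]; last by rewrite /layer hK//= (negbTE no).
move=> /(congr1 co); rewrite hK// /emb hK ?club_next_ge// => -[bE mE tE].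
by move: no; rewrite mE tE bE !eqxx.
Qed.

(** From [t] to the end of its gap, the image under [emb n] is an interval, so a point outside the
    range cannot fall inside it. The end of the gap then supplies a zero to compare with. *)
Lemma emb_next_le n t w : (forall t', w <> emb n t') -> (emb n t <= w)%O -> (emb n (c t) <= w)%O.
Proof.
move=> wn; rewrite le_eqVlt => /predU1P[/esym/wn//|tw].
rewrite leNgt; apply/negP => wt.
have [b [m [q [qb wE]]]] := hP w; subst w.
have ge := club_next_ge hW s t.
move: tw => /(h_lt _ _ ge qb)[/= tb|/= [tb tw]].
  move: wt => /(h_lt _ _ qb (club_next_ge hW s _)); rewrite next_next.
  case=> /= [bt|[bt _]]; first by have := lt_trans tb bt; rewrite ltxx.
  by move: tb; rewrite bt ltxx.
move: wt => /(h_lt _ _ qb (club_next_ge hW s _)); rewrite next_next.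
case=> /= [bt|[_]]; first by move: bt; rewrite tb ltxx.
case: tw => [nm [mn|[mn _]]|[nm tq] [mn|[mn qt]]].
- by have := ltn_trans nm mn; rewrite ltnn.
- by move: nm; rewrite mn ltnn.
- by move: mn; rewrite nm ltnn.
apply: (wn q); rewrite /emb -tb mn; congr h.
by rewrite tb (@club_next_between _ _ hW s t q) ?(ltW tq)// ltW.
Qed.

(** The control function is carried over by a supremum over the part of the range already passed. An
    increment between a point of the range and one outside it is estimated through an intermediate
    zero of [x] on the club. *)
Lemma layer_pvar n x : (forall a, club s a -> val x a = 0) ->
  pvar_le p (layer n x) (2 * nrm x `^ p).
Proof.
move=> xs.
have [w00] := is_omega1_nonempty hW.
have [w0 _ w0P'] := omega1_min hW (A := setT) (ex_intro _ w00 I).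
have w0P t : (w0 <= t)%O by exact: w0P'.
have [Om xO OM] := james_pvar x.
have Omh a b : (a <= b)%O -> Om a <= Om b.
  by move=> /xO ab; rewrite -subr_ge0; apply: le_trans ab; exact: powR_ge0.
pose M := nrm x `^ p.
(* The floor [Om w0 - M] serves the points before the whole range, from which the layer may jump by
   as much as the norm; it is the origin of the factor 2. *)
pose S w := [set r | r = Om w0 - M \/ exists2 t, (emb n t <= w)%O & r = Om t].
pose Th w := sup (S w).
have S0 w : S w (Om w0 - M) by left.
have M0 : 0 <= M by exact: powR_ge0.
have Sub w r : S w r -> r <= Om w0 + M.
  case=> [->|[t _ ->]]; first by rewrite lerD2l (le_trans _ M0)// oppr_le0.
  by rewrite -lerBlDl.
have Shas w : has_sup (S w) by split; [exists (Om w0 - M)|exists (Om w0 + M) => r /Sub].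
have Sle w r : S w r -> r <= Th w by move=> Sr; apply: ub_le_sup => //; case: (Shas w).
have Thle w r : (forall r', S w r' -> r' <= r) -> Th w <= r.
  by move=> H; apply: ge_sup => //; exists (Om w0 - M).
have Thmono v w : (v <= w)%O -> Th v <= Th w.
  move=> vw; apply: Thle => r [->|[t tv ->]]; first exact: Sle.
  by apply: Sle; right; exists t => //; exact: le_trans vw.
have emb_le_inv t t' : (emb n t <= emb n t')%O -> (t <= t')%O.
  by rewrite leNgt => tt'; rewrite leNgt; apply: contra tt'; exact: emb_lt.
have Themb t : Th (emb n t) = Om t.
  apply/le_anti/andP; split; last by apply: Sle; right; exists t.
  apply: Thle => r [->|[t' /emb_le_inv tt' ->]]; last exact: Omh.
  by rewrite lerBlDr -lerBlDl.
have xc t : val x (c t) = 0 by apply: xs; exact: club_nextP.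
exists Th => [v w vw|v w]; last first.
  have : Th w - Th v <= (Om w0 + M) - (Om w0 - M).
    by apply: lerB; [apply: Thle => r /Sub|exact: Sle].
  by have -> : Om w0 + M - (Om w0 - M) = 2 * M by ring.
have [[t tE]|[nw lw]] := layerP n x w; have [[t' tE']|[nv lv]] := layerP n x v.
- subst v w; rewrite !layer_emb !Themb; apply: xO; exact: emb_le_inv.
- subst w; rewrite lv layer_emb subr0 Themb lerBrDl -lerBrDr.
  apply: Thle => r [->|[t0 t0v ->]].
    rewrite lerBrDr -lerBrDl opprB addrCA.
    apply: (@le_trans _ _ M).
      by apply: (ler_powR2 p1 (normc_ge0 _)); exact: james_eval.
    by rewrite lerDl subr_ge0 Omh.
  rewrite lerBrDr -lerBrDl.
  have ct : (c t0 <= t)%O by apply: emb_le_inv; apply: le_trans vw; exact: emb_next_le.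
  have := xO _ _ ct; rewrite xc subr0 => /le_trans; apply.
  by rewrite lerB// Omh// club_next_ge.
- subst v; rewrite lw layer_emb sub0r normcN Themb.
  have := xO _ _ (club_next_ge hW s t'); rewrite xc sub0r normcN => /le_trans; apply.
  by rewrite lerB// -Themb Thmono// emb_next_le.
- by rewrite lw lv subrr normc00 powR0 ?gt_eqF// subr_ge0 Thmono.
Qed.

(** The sum of all [layer n (z n)]: at [w] only the layer numbered by the block of [w] can be
    nonzero. *)
Definition join_blocks (z : nat -> J) w : R[i]^o := layer (co w).1.2 (z (co w).1.2) w.

Lemma join_blocksE (z : nat -> J) b n t : (t <= b)%O ->
  join_blocks z (h b n t) = if c t == b then val (z n) t else 0.
Proof. by move=> tb; rewrite /join_blocks /layer hK//= eqxx. Qed.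

Lemma join_blocks_emb (z : nat -> J) n t : join_blocks z (emb n t) = val (z n) t.
Proof. by rewrite /emb join_blocksE ?club_next_ge// eqxx. Qed.

(** A finite chain meets finitely many layers, whose supports are disjoint, and the constant of
    [pvar_le_sum] does not depend on their number. *)
Lemma join_blocks_pvar (z : nat -> J) K : (forall n a, club s a -> val (z n) a = 0) ->
  (forall N, \sum_(n < N) nrm (z n) `^ p <= K) -> pvar_le p (join_blocks z) (2 `^ p * (2 * K)).
Proof.
move=> zs zK; apply: (pvar_leP p1) => k u ku.
pose N := (\max_(i < k.+1) (co (u i)).1.2).+1.
have uN i : (i <= k)%N -> ((co (u i)).1.2 < N)%N.
  by rewrite -ltnS => ik; rewrite ltnS; exact: (leq_bigmax (Ordinal ik)).
have gE i : (i <= k)%N -> join_blocks z (u i) = \sum_(n < N) layer n (z n) (u i).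
  move=> /uN iN; rewrite (bigD1 (Ordinal iN))//= big1 ?addr0// => n.
  by rewrite -val_eqE /= /layer eq_sym => /negbTE ->.
have -> : pvar_sum p (join_blocks z) k u = pvar_sum p (fun w => \sum_(n < N) layer n (z n) w) k u.
  by apply: eq_bigr => i _; rewrite !gE// ltnW.
apply: (pvar_sum_le _ ku).
apply: (@pvar_le_weak _ p _ _ _ (2 `^ p * \sum_(n < N) 2 * nrm (z n) `^ p)); last first.
  by rewrite ler_wpM2l ?powR_ge0// -mulr_sumr ler_wpM2l.
apply: (pvar_le_sum p1) => [i j t ij|i]; last by apply: layer_pvar; exact: zs.
rewrite /layer; have [ti|] := eqVneq (co t).1.2 (val i); last by left.
by right; rewrite ti val_eqE (negbTE ij).
Qed.

Lemma join_blocks_left_cont (z : nat -> J) K : (forall n a, club s a -> val (z n) a = 0) ->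
  (forall t, val (z 0%N) t = 0) ->
  (forall N, \sum_(n < N) nrm (z n) `^ p <= K) -> left_cont (join_blocks z).
Proof.
move=> zs z0 zK; apply: (left_cont_frequently p1 (join_blocks_pvar zs zK)) => w v e vw e0 lim.
have [b [m [t [tb wE]]]] := hP w; subst w.
have [[t0 t0t]|t_min] := pselect (exists t0, (t0 < t)%O); last first.
  have tle q : (t <= q)%O by rewrite leNgt; apply/negP => qt; apply: t_min; exists q.
  (* For a positive number, the first point of the block comes right after the last point of the
     preceding one and is not a limit. *)
  case: m => [|m] in vw lim *; last first.
    have [|u /andP[]] := lim (h b m b).
      by apply/h_lt => //; right; split => //; left.
    have [b' [m' [q [qb' ->]]]] := hP u.
    move=> /(h_lt _ _ (lexx b) qb') bl /(h_lt _ _ qb' tb) [/= bb|/= [bb]].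
      by case: bl => /= [bb'|[bb' _]]; [have := lt_trans bb bb'|move: bb; rewrite bb']; rewrite ltxx.
    subst b'; case: bl => /= [bb|[_ bl]]; first by move: bb; rewrite ltxx.
    case: bl => [mm|[mm bq]]; last by move: qb'; rewrite leNgt bq.
    case=> [mm'|[mm' qt]]; first by move: (leq_trans mm mm'); rewrite ltnn.
    by move: qt; rewrite ltNge tle.
  have [b' [m' [q [qb' vE]]]] := hP v; subst v.
  have bb' : (b' < b)%O.
    move: vw => /(h_lt _ _ qb' tb)[//|/= [_ [//|[_]]]].
    by rewrite ltNge tle.
  (* At the first point of a block (b, 0) the value is zero because layer 0 is empty. It is
     approached along last points of blocks, where the value is zero as well: such a point either
     lies outside the range of the copy or comes from a club point. *)
  exists (h b' m'.+1 b').
    apply/andP; split; apply/h_lt => //; last by left.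
    by right; split => //; left.
  rewrite !join_blocksE// z0 if_same subr0.
  case: eqP => [cb'|_]; last by rewrite normc00.
  by rewrite zs ?normc00// -cb'; exact: club_nextP.
have [r rt rP] := h_limit_lt tb t0t vw.
have lim' q : (q < t)%O -> exists u, (q < u < t)%O.
  move=> qt; have qb := le_trans (ltW qt) tb.
  have [|u /andP[]] := lim (h b m q); first by apply/h_lt => //; right; split => //; right.
  have [b' [m' [u' [ub' ->]]]] := hP u.
  move=> /(h_lt _ _ qb ub') bl /(h_lt _ _ ub' tb) [/= bb|/= [bb]].
    by case: bl => /= [bb'|[bb' _]]; [have := lt_trans bb bb'|move: bb; rewrite bb']; rewrite ltxx.
  subst b'; case: bl => /= [bb|[_ bl]]; first by move: bb; rewrite ltxx.
  case=> [mm|[mm ut]]; case: bl => [mm'|[mm' qu]].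
  - by have := ltn_trans mm mm'; rewrite ltnn.
  - by move: mm; rewrite mm' ltnn.
  - by move: mm'; rewrite mm ltnn.
  - by exists u'; rewrite qu.
have inw u : (r < u)%O -> (u < t)%O -> (v < h b m u < h b m t)%O.
  move=> ru ut; rewrite rP ?ru//=; apply/h_lt => //; first exact: le_trans (ltW ut) tb.
  by right; split => //; right.
have [[u0 u0t cu0]|nou] := pselect (exists2 u0, (u0 < t)%O & c u0 = b).
  have cu u : (u0 <= u)%O -> (u <= t)%O -> c u = b.
    by move=> u0u ut; rewrite (@club_next_between _ _ hW s u0)// cu0 (le_trans ut).
  have [r' r't r'P] := @james_left_cont _ _ p1 _ _ hW (z m) t e (ex_intro _ t0 t0t) e0.
  have [u /andP[]] := lim' (Order.max r (Order.max r' u0)) ltac:(by rewrite !gt_max rt r't).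
  rewrite !gt_max => /and3P[ru r'u u0u] ut.
  exists (h b m u); first exact: inw.
  have ub := le_trans (ltW ut) tb.
  by rewrite !join_blocksE// !cu ?eqxx ?(ltW u0u) ?(ltW ut) ?lexx ?(ltW u0t)// r'P// r'u.
(* No point below [t] belongs to the gap ending at [b], so the value at [u] is zero. If [t] itself
   belongs to that gap, it is a limit of club points, hence in the club, and its value is zero
   too. *)
have [u /andP[ru ut]] := lim' r rt.
exists (h b m u); first exact: inw.
rewrite !join_blocksE//; last exact: le_trans (ltW ut) tb.
case: eqP => [cu|_]; first by exfalso; apply: nou; exists u.
case: eqP => [ct|_]; last by rewrite subrr normc00.
rewrite zs ?subrr ?normc00//.
apply: (club_next_limit lim'); first by exists t0.
move=> q qt; have [cq|//] := club_next_gap qt.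
by exfalso; apply: nou; exists q; rewrite // cq.
Qed.

Lemma join_blocks_james (z : nat -> J) K : (forall n a, club s a -> val (z n) a = 0) ->
  (forall t, val (z 0%N) t = 0) ->
  (forall N, \sum_(n < N) nrm (z n) `^ p <= K) -> join_blocks z \in in_james p1 hW.
Proof.
move=> zs z0 zK.
have [a aP] := choice (fun n => james_support (z n)).
have [A AP] := omega1_seq_ub hW a.
have [b bP] := omega1_succ hW (c A).
apply: (james_intro p1 hW (a := h b 0%N b) _ _ (join_blocks_pvar zs zK)).
  exact: join_blocks_left_cont zs z0 zK.
move=> w; have [b' [m [t [tb' ->]]]] := hP w => le.
rewrite join_blocksE//; case: eqP => // cb'.
apply: (aP m); apply: le_trans (ltW (AP m)) _.
rewrite leNgt; apply/negP => tA.
have b'b : (b' < b)%O by rewrite -cb'; apply: le_lt_trans bP; apply/club_next_mono/ltW.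
move: le; rewrite leNgt => /negP; apply; apply/h_lt => //; by left.
Qed.

(* z assembles x into a sequence of functions that vanish on the club and are
   l^p summable; join_blocks z places its n-th term in the blocks (_, n). *)
Lemma exists_join_blocks (z : J -> nat -> J) (m : R) : 0 <= m ->
  (forall (b : R[i]) x y n t, val (z (b *: x + y) n) t = b * val (z x n) t + val (z y n) t) ->
  (forall x n a, club s a -> val (z x n) a = 0) ->
  (forall x t, val (z x 0%N) t = 0) ->
  (forall x N, \sum_(n < N) nrm (z x n) `^ p <= m * nrm x `^ p) ->
  exists T : B, forall x t, val (val T x) t = join_blocks (z x) t.
Proof.
move=> m0 zl zs z0 zK; apply: (@op_exists (fun x => join_blocks (z x)) (2 `^ p * (2 * m))).
- move=> b x y w; have [b' [k [t [tb' ->]]]] := hP w; rewrite !join_blocksE//.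
  by case: eqP => _; [exact: zl|rewrite mulr0 addr0].
- by move=> x; apply: join_blocks_james (zs x) (z0 x) (zK x).
- by rewrite !mulr_ge0// powR_ge0.
- by move=> x; rewrite -!mulrA; exact: (join_blocks_pvar (zs x) (zK x)).
Qed.

End Next.
End Operators.

(** * K_0 of a ring with a character and swindles *)

Section K0Class.
Local Open Scope quotient_scope.
Context {A : pzRingType}.
Implicit Types e f : idem A.

Definition K0_class e : K0 A := \pi_(groth (idem_class A)) (\pi_(idem_class A) e, 0).

Lemma K0_class_rel e f : idem_rel e f -> K0_class e = K0_class f.
Proof. by move=> ef; congr (\pi_(groth (idem_class A)) (_, _)); apply/eqquotP. Qed.

Lemma K0_class_sum e f : K0_class (idem_sum e f) = K0_class e + K0_class f.
Proof.
rewrite /K0_class -[RHS]/(groth_add _ _) pi_groth_add; congr (\pi_(_) (_, _)).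
  by rewrite -[RHS]/(idem_class_add _ _) pi_idem_add.
by rewrite addr0.
Qed.

Lemma K0_pair e f : \pi_(groth (idem_class A)) (\pi_(idem_class A) e, \pi_(idem_class A) f)
  = K0_class e - K0_class f :> K0 A.
Proof.
rewrite -[RHS]/(groth_add _ (groth_opp _)) /K0_class pi_groth_opp pi_groth_add /=.
by congr (\pi_(_) (_, _)); rewrite ?addr0 ?add0r.
Qed.

(* Eilenberg swindle data for the corner QAQ: f00 plays the role of an infinite
   direct sum g + g + ..., the maps f10 and f01 shift its summands by one, and
   u and v insert and extract the first one. *)
Definition swindle (Q : A) : Prop :=
  exists (v : A) (u f00 f10 f01 : A -> A),
    [/\ forall g h, f00 (g + h) = f00 g + f00 h,
        forall g h, Q * h = h -> u g * (h * v) + f10 g * f01 h = f00 (g * h),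
        forall g h, Q * h = h -> f00 g * f00 h = f00 (g * h) /\ f01 g * f10 h = f00 (g * h),
        forall g, v * u g = Q * g &
        forall g h, v * f10 g = 0 /\ f01 g * u h = 0].

(** Entrywise, [f00] turns the idempotent g into G, in the role of g + g + .... Splitting off the
    first summand with u and v and shifting the others gives G ~ g + G, and the class of G
    cancels. *)
Lemma K0_class_swindle (Q : A) e : swindle Q ->
  (forall i j, Q * idem_mx e i j = idem_mx e i j) -> K0_class e = 0.
Proof.
case: e => n g gg [v [u [f00 [f10 [f01 [addf H1 H2 H3 H4]]]]]] /= Qg.
have f00_0 : f00 0 = 0 by apply: (addrI (f00 0)); rewrite -addf !addr0.
have f00_sum (F : 'I_n -> A) : f00 (\sum_k F k) = \sum_k f00 (F k).
  by apply: (big_morph f00) => //; exact: addf.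
have ggE i j : \sum_k g i k * g k j = g i j by rewrite -[in RHS]gg mxE.
pose G : 'M[A]_n := \matrix_(i, j) f00 (g i j).
have GG : G *m G = G.
  apply/matrixP => i j; rewrite !mxE -[in RHS]ggE f00_sum.
  by apply: eq_bigr => k _; rewrite !mxE (H2 _ _ (Qg _ _)).1.
have : idem_rel (Idem GG) (idem_sum (Idem gg) (Idem GG)).
  apply/asboolP => /=.
  exists (row_mx (\matrix_(i, j) u (g i j)) (\matrix_(i, j) f10 (g i j))).
  exists (col_mx (\matrix_(i, j) (g i j * v)) (\matrix_(i, j) f01 (g i j))).
  rewrite mul_row_col mul_col_row; split.
    apply/matrixP => i j; rewrite !mxE -[in RHS]ggE f00_sum -big_split /=.
    by apply: eq_bigr => k _; rewrite !mxE H1.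
  congr block_mx; apply/matrixP => i j; rewrite !mxE.
  - by rewrite -[in RHS]ggE; apply: eq_bigr => k _; rewrite !mxE -mulrA H3 Qg.
  - by rewrite big1// => k _; rewrite !mxE -mulrA (H4 _ 0).1 mulr0.
  - by rewrite big1// => k _; rewrite !mxE (H4 _ _).2.
  - rewrite -[in RHS]ggE f00_sum.
    by apply: eq_bigr => k _; rewrite !mxE (H2 _ _ (Qg _ _)).2.
move=> /K0_class_rel; rewrite K0_class_sum => /(congr1 (fun x => x - K0_class (Idem GG))).
by rewrite subrr addrK.
Qed.

(* E *m e = d *m E says that e is block triangular for the decomposition
   1 = E + (1 - E), with diagonal blocks d *m E and e - e *m E. *)
Lemma K0_class_triangular n (e d E : 'M[A]_n) (ee : e *m e = e)
    (kk : (d *m E) *m (d *m E) = d *m E) (gg : (e - e *m E) *m (e - e *m E) = e - e *m E) :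
  d *m d = d -> E *m E = E -> E *m e = d *m E ->
  K0_class (Idem ee) = K0_class (Idem gg) + K0_class (Idem kk).
Proof.
move=> dd EE Ee.
(* Here e is the sum of the orthogonal idempotents e - e k and e k; the first is equivalent to g,
   the second to k. *)
have main (k g : 'M[A]_n) : e *m g = g -> k *m e = k -> k *m g = 0 -> g *m e = e - e *m k ->
    k *m k = k -> row_mx g (e *m k) *m col_mx (e - e *m k) k = e /\
    col_mx (e - e *m k) k *m row_mx g (e *m k) = block_mx g 0 0 k.
  move=> eg ke kg ge kk'; rewrite mul_row_col mul_col_row; split.
    rewrite mulmxBr mulmxA ge mulmxBl -[e *m k *m k]mulmxA kk' subrr subr0.
    by rewrite subrK.
  congr block_mx.
  - by rewrite mulmxBl eg -mulmxA kg mulmx0 subr0.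
  - by rewrite mulmxBl !mulmxA ee -[e *m k *m e]mulmxA ke -[e *m k *m k]mulmxA kk' subrr.
  - exact: kg.
  - by rewrite mulmxA ke kk'.
have Eg : E *m (e - e *m E) = 0 by rewrite mulmxBr mulmxA Ee -mulmxA EE subrr.
rewrite -K0_class_sum; apply: K0_class_rel; apply/asboolP => /=.
exists (row_mx (e - e *m E) (e *m (d *m E))), (col_mx (e - e *m (d *m E)) (d *m E)).
apply: main => //.
- by rewrite mulmxBr mulmxA ee.
- by rewrite -mulmxA Ee mulmxA dd.
- by rewrite -mulmxA Eg mulmx0.
- by rewrite mulmxBl ee -mulmxA Ee.
Qed.

Lemma idem_mx1 n : (1%:M : 'M[A]_n) *m 1%:M = 1%:M.
Proof. exact: mul1mx. Qed.

Lemma K0_class_scalar n : K0_class (Idem (idem_mx1 n)) = K0_class (Idem (idem_mx1 1)) *+ n.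
Proof.
elim: n => [|n ih].
  rewrite mulr0n -[RHS]/(\pi_(groth (idem_class A)) 0) /K0_class.
  congr (\pi_(_) (_, _)); apply/eqquotP/asboolP => /=.
  by exists 0, 0; split; apply/matrixP => -[].
rewrite mulrS -ih -K0_class_sum; apply: K0_class_rel; apply/asboolP => /=.
rewrite -(scalar_mx_block 1 n); exists 1%:M, 1%:M; rewrite mul1mx.
by split.
Qed.

End K0Class.

(** * The rank of the image under a character *)

Section K0Integers.
Local Open Scope quotient_scope.
Context {A : pzRingType} {F : fieldType} (lam : {rmorphism A -> F}) (iota : {rmorphism F -> A}).
(** The properties of operators on which the algebra relies. [E] may vary with the matrix, because
    the club has to suit all its entries. *)
Hypothesis corner : forall n (e : 'M[A]_n), exists E : A,
  [/\ E * E = E, forall c, E * iota c = iota c * E,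
      forall i j, E * e i j = iota (lam (e i j)) * E & swindle (1 - E)].

Definition idem_rank (e : idem A) : nat := \rank (map_mx lam (idem_mx e)).

Lemma idem_rank_rel e f : idem_rel e f -> idem_rank e = idem_rank f.
Proof.
wlog suff H : e f / idem_rel e f -> (idem_rank e <= idem_rank f)%N.
  move=> ef; apply/eqP; rewrite eqn_leq !H//.
  by move: ef; rewrite (@idem_rel_sym A).
move=> /asboolP[x [y [xy yx]]]; rewrite /idem_rank -idem_mxK -xy.
have -> : x *m y *m (x *m y) = x *m idem_mx f *m y by rewrite -yx !mulmxA.
rewrite !map_mxM; apply: leq_trans (mxrankM_maxl _ _) _; exact: mxrankM_maxr.
Qed.

Lemma idem_rank_sum e f : idem_rank (idem_sum e f) = (idem_rank e + idem_rank f)%N.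
Proof. by rewrite /idem_rank /= map_block_mx !raddf0 rank_diag_block_mx. Qed.

Lemma idem_rank0 : idem_rank (idem0 A) = 0%N.
Proof. by apply/eqP; rewrite -leqn0 rank_leq_row. Qed.

(** In a full rank factorization of an idempotent, the product of the factors in the opposite order
    is the identity matrix, of size the rank. *)
Lemma K0_class_field n (c : 'M[F]_n) (cc : c *m c = c)
    (dd : map_mx iota c *m map_mx iota c = map_mx iota c) :
  K0_class (Idem dd) = K0_class (Idem (idem_mx1 1)) *+ \rank c.
Proof.
rewrite -K0_class_scalar; apply: K0_class_rel; apply/asboolP => /=.
exists (map_mx iota (col_base c)), (map_mx iota (row_base c)).
rewrite -!map_mxM mulmx_base; split => //.
have -> : row_base c *m col_base c = 1%:M; last exact: map_mx1.
apply: (row_full_inj (col_base_full c)); apply: (row_free_inj (row_base_free c)) => /=.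
by rewrite mulmx1 mulmxA mulmx_base -mulmxA mulmx_base cc.
Qed.

Lemma K0_class_rank e : K0_class e = K0_class (Idem (idem_mx1 1)) *+ idem_rank e.
Proof.
case: e => n e ee; rewrite /idem_rank /=.
pose c := map_mx lam e; pose d := map_mx iota c.
have cc : c *m c = c by rewrite -map_mxM ee.
have dd : d *m d = d by rewrite -map_mxM cc.
rewrite -(K0_class_field cc dd).
have [E0 [EE Ec Ee sw]] := corner e.
pose E : 'M[A]_n := E0%:M.
have El (a : 'M[A]_n) i j : (E *m a) i j = E0 * a i j by rewrite mul_scalar_mx mxE.
have Er (a : 'M[A]_n) i j : (a *m E) i j = a i j * E0.
  rewrite mxE (bigD1 j)//= !mxE eqxx mulr1n big1 ?addr0// => k kj.
  by rewrite !mxE (negbTE kj) mulr0n mulr0.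
have EEm : E *m E = E.
  by apply/matrixP => i j; rewrite El mxE; case: eqP => _; rewrite ?mulr1n ?mulr0n ?EE ?mulr0.
have Ed : E *m d = d *m E by apply/matrixP => i j; rewrite El Er !mxE Ec.
have Eem : E *m e = d *m E by apply/matrixP => i j; rewrite El Er !mxE Ee.
have idem_gg (a : 'M[A]_n) : a *m a = a -> E *m a = d *m E ->
    (a - a *m E) *m (a - a *m E) = a - a *m E.
  move=> aa Ea.
  have Eg : E *m (a - a *m E) = 0 by rewrite mulmxBr mulmxA Ea -mulmxA EEm subrr.
  by rewrite mulmxBl -[a *m E *m _]mulmxA Eg mulmx0 subr0 mulmxBr mulmxA aa.
have kk : (d *m E) *m (d *m E) = d *m E.
  by rewrite -mulmxA [E *m (d *m E)]mulmxA Ed -[d *m E *m E]mulmxA EEm mulmxA dd.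
have gone (a : 'M[A]_n) (gg : (a - a *m E) *m (a - a *m E) = a - a *m E) :
    E *m a = d *m E -> K0_class (Idem gg) = 0.
  move=> Ea; apply: (K0_class_swindle sw) => i j /=.
  have Eg : E *m (a - a *m E) = 0 by rewrite mulmxBr mulmxA Ea -mulmxA EEm subrr.
  by rewrite mulrBl mul1r -El Eg [X in _ - X]mxE subr0.
rewrite (K0_class_triangular ee kk (idem_gg _ ee Eem) dd EEm Eem).
rewrite (K0_class_triangular dd kk (idem_gg _ dd Ed) dd EEm Ed).
by rewrite !gone.
Qed.

Definition class_rank (a : idem_class A) : nat := idem_rank (repr a).

Lemma class_rank_pi e : class_rank (\pi_(idem_class A) e) = idem_rank e.
Proof. exact/idem_rank_rel/idem_repr. Qed.

Lemma class_rank0 : class_rank 0 = 0%N.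
Proof. by rewrite -[RHS]idem_rank0 -class_rank_pi. Qed.

Lemma class_rankD a b : class_rank (a + b) = (class_rank a + class_rank b)%N.
Proof.
rewrite -[a + b]/(\pi_(idem_class A) (idem_sum (repr a) (repr b))) class_rank_pi.
exact: idem_rank_sum.
Qed.

Definition K0_rank (x : K0 A) : int :=
  (class_rank (repr (x : groth _)).1)%:Z - (class_rank (repr (x : groth _)).2)%:Z.

Lemma K0_rank_pi (u : idem_class A * idem_class A) :
  K0_rank (\pi_(groth (idem_class A)) u) = (class_rank u.1)%:Z - (class_rank u.2)%:Z.
Proof.
rewrite /K0_rank; set v := repr _.
have /asboolP[k /(congr1 class_rank)] : groth_rel v u by exact: groth_repr.
rewrite !class_rankD => /addIn /(congr1 Posz); rewrite !PoszD => vu.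
by apply/eqP; rewrite subr_eq addrAC -vu addrK.
Qed.

Fact K0_rank_zmod_morphism : zmod_morphism K0_rank.
Proof.
move=> x y; pose u := repr (x : groth (idem_class A)); pose v := repr (y : groth (idem_class A)).
have -> : x - y = \pi_(groth (idem_class A)) (u + (v.2, v.1)).
  by rewrite -pi_groth_add reprK.
rewrite K0_rank_pi /= !class_rankD !PoszD /K0_rank -/u -/v.
by rewrite /=; ring.
Qed.

HB.instance Definition _ := GRing.isZmodMorphism.Build (K0 A) int K0_rank K0_rank_zmod_morphism.

Theorem K0_int : exists f : {additive K0 A -> int}, bijective f.
Proof.
exists K0_rank; pose one := K0_class (Idem (@idem_mx1 A 1)).
have K (x : K0 A) : one *~ K0_rank x = x.
  rewrite -[x](@reprK _ (groth (idem_class A))); case: (repr _) => a b.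
  rewrite K0_rank_pi /= -[a]reprK -[b]reprK K0_pair !class_rank_pi.
  by rewrite mulrzBr -!pmulrn -!K0_class_rank.
have one1 : K0_rank one = 1.
  rewrite K0_rank_pi /= class_rank_pi /idem_rank /= map_mx1 mxrank1.
  by rewrite class_rank0 subr0.
exists (fun z => one *~ z) => [x|z]; first exact: K.
by rewrite raddfMz /= one1 intz.
Qed.

End K0Integers.

(** * The K_0-group *)

Section Character.
Context {R : realType} {p : R} (p1 : 1 < p).
Context {d : Order.disp_t} {W : orderTopologicalType d} (hW : is_omega1 W).
Local Notation J := (james p1 hW).
Local Notation B := (bounded_op J).
Implicit Types (x y : J) (a b t : W) (S T : B).

Let p0 : 0 < p. Proof. exact: lt_trans p1. Qed.

Lemma bounded_op_ext S T : (forall x t, val (val S x) t = val (val T x) t) -> S = T.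
Proof.
by move=> ST; apply: val_inj; apply/funext => x; apply: val_inj; apply/funext => t.
Qed.

Lemma op_mulE S T x : val (S * T) x = val S (val T x). Proof. by []. Qed.

Lemma op_addE S T x : val (S + T) x = val S x + val T x. Proof. by []. Qed.

Lemma op_subE S T x : val (S - T) x = val S x - val T x. Proof. by []. Qed.

Lemma op_oneE x : val (1 : B) x = x. Proof. by []. Qed.

Lemma op0 T : val T 0 = 0.
Proof.
have := op_linear T 1 0 0; rewrite !scale1r addr0 => /esym/eqP.
by rewrite -subr_eq0 addrK => /eqP.
Qed.

Lemma diagonal_unique T l l' s s' : diagonal_on T l s -> diagonal_on T l' s' -> l = l'.
Proof.
move=> Tl Tl'; have [w0] := is_omega1_nonempty hW.
have [a ca _] := club_unbounded hW (fun t => Order.max (s t) (s' t)) w0.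
have := Tl a (club_maxl ca) (indJ p1 hW a).
by rewrite (Tl' a (club_maxr ca)) /= /ind lexx !mulr1.
Qed.

Definition character T : R[i] := projT1 (cid (op_diagonal T)).

Lemma characterP T : exists s, diagonal_on T (character T) s.
Proof. by rewrite /character; case: cid. Qed.

Lemma characterE T l s : diagonal_on T l s -> character T = l.
Proof. by move=> Tl; have [s' Ts'] := characterP T; exact: diagonal_unique Ts' Tl. Qed.

Fact character_zmod_morphism : zmod_morphism character.
Proof.
move=> S T; have [s Ss] := characterP S; have [t Tt] := characterP T.
apply: (@characterE _ _ (fun b => Order.max (s b) (t b))) => a ca x.
by rewrite op_subE valJB (Ss _ (club_maxl ca)) (Tt _ (club_maxr ca)) mulrBl.
Qed.

Fact character_monoid_morphism : monoid_morphism character.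
Proof.
split; first by apply: (@characterE _ _ id) => a _ x; rewrite op_oneE mul1r.
move=> S T; have [s Ss] := characterP S; have [t Tt] := characterP T.
apply: (@characterE _ _ (fun b => Order.max (s b) (t b))) => a ca x.
by rewrite op_mulE (Ss _ (club_maxl ca)) (Tt _ (club_maxr ca)) mulrA.
Qed.

HB.instance Definition _ :=
  GRing.isZmodMorphism.Build B R[i] character character_zmod_morphism.
HB.instance Definition _ :=
  GRing.isMonoidMorphism.Build B R[i] character character_monoid_morphism.

Lemma exists_scalar (l : R[i]) : exists T : B, forall x, val T x = l *: x.
Proof.
have [T TP] : exists T : B, forall x t, val (val T x) t = val (l *: x) t.
  apply: (@op_exists _ _ p1 _ _ hW (fun x => val (l *: x)) (normc l `^ p)).
  - by move=> c x y t; rewrite !valJZ valJD valJZ; ring.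
  - by move=> x; exact: valP.
  - exact: powR_ge0.
  - move=> x; rewrite -powRM ?normc_ge0 ?nrm_ge0// -nrmZ; exact: james_pvar.
by exists T => x; apply: val_inj; apply/funext => t.
Qed.

Definition scalar_op (l : R[i]) : B := projT1 (cid (exists_scalar l)).

Lemma scalar_opE l x : val (scalar_op l) x = l *: x.
Proof. by rewrite /scalar_op; case: cid. Qed.

Fact scalar_op_zmod_morphism : zmod_morphism scalar_op.
Proof. by move=> l m; apply: bounded_op_ext => x t; rewrite op_subE !scalar_opE scalerBl. Qed.

Fact scalar_op_monoid_morphism : monoid_morphism scalar_op.
Proof.
split; first by apply: bounded_op_ext => x t; rewrite scalar_opE scale1r.
by move=> l m; apply: bounded_op_ext => x t; rewrite op_mulE !scalar_opE scalerA.
Qed.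

HB.instance Definition _ :=
  GRing.isZmodMorphism.Build R[i] B scalar_op scalar_op_zmod_morphism.
HB.instance Definition _ :=
  GRing.isMonoidMorphism.Build R[i] B scalar_op scalar_op_monoid_morphism.

(** * The swindle on functions vanishing on a club *)

Section Swindle.
Context (s : W -> W) (E : B).
Local Notation c := (club_next hW s).
Hypothesis EP : forall x t, val (val E x) t = val x (c t).

Lemma compl_next x t : val (val (1 - E) x) t = val x t - val x (c t).
Proof. by rewrite op_subE valJB EP. Qed.

Lemma compl_next_club x a : club s a -> val (val (1 - E) x) a = 0.
Proof. by move=> sa; rewrite compl_next club_next_id// subrr. Qed.

(** [V k] reads slot k, that is, the copy numbered k, and joining writes all slots. Reading inverts
    writing for sequences vanishing on the club, so each identity of the swindle is checked slot by
    slot. *)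
Lemma swindle_next : swindle (1 - E).
Proof.
have [h [co [co_le coK hK co_lt]]] := omega1_blocks hW.
have [V VP] := choice (exists_unblock p1 hW s co_le coK hK co_lt).
have Qs := compl_next_club; move: (1 - E) Qs => Q Qs.
have g0 (g : B) : exists2 m : R, 0 <= m & forall x, nrm (val (Q * g) x) `^ p <= m * nrm x `^ p.
  have [m m0 gm] := op_bound (Q * g); exists (m `^ p) => [|x]; first exact: powR_ge0.
  by rewrite -powRM ?nrm_ge0//; apply: (ler_powR2 p1 (nrm_ge0 _)); exact: gm.
(* r m = Some k means that slot m of the result receives slot k of the argument, after [Q * g]; with
   None it stays empty. The condition [ok] leaves slot 0 empty and preserves summability, with N.+1
   source slots since an index grows by at most one. *)
pose Z (r : nat -> option nat) (g : B) x m : J :=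
  if r m is Some k then val (Q * g) (val (V k) x) else 0.
pose ok (r : nat -> option nat) := r 0%N = None /\
  forall (a : nat -> R) N, (forall n, 0 <= a n) ->
    \sum_(n < N) (if r n is Some k then a k else 0) <= \sum_(k < N.+1) a k.
have shift r (g : B) : exists T : B, ok r -> forall x t, val (val T x) t = join_blocks s co (Z r g x) t.
  (* The zero operator is a default value for inadmissible maps of slots. *)
  have [[r0 rP]|nok] := pselect (ok r); last by exists 0.
  have [m m0 gm] := g0 g.
  have [T TP] : exists T : B, forall x t, val (val T x) t = join_blocks s co (Z r g x) t.
    apply: (exists_join_blocks co_le coK hK co_lt (m := m * (2 `^ p * 2))).
    - by rewrite !mulr_ge0// powR_ge0.
    - move=> b x y n t; rewrite /Z; case: (r n) => [k|]; last by rewrite valJ0 mulr0 addr0.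
      by rewrite !op_linear valJD valJZ.
    - by move=> x n a sa; rewrite /Z; case: (r n) => // k; exact: Qs.
    - by move=> x t; rewrite /Z r0.
    move=> x N; apply: (@le_trans _ _ (\sum_(k < N.+1) m * nrm (val (V k) x) `^ p)).
      apply: le_trans (rP (fun k => m * nrm (val (V k) x) `^ p) N _).
        apply: ler_sum => n _; rewrite /Z; case: (r n) => [k|]; first exact: gm.
        by rewrite nrm0 powR0 ?gt_eqF.
      by move=> n; rewrite mulr_ge0 ?powR_ge0.
    rewrite -mulr_sumr -!mulrA ler_wpM2l//.
    by apply: (unblock_sum hK co_lt N.+1 (z := fun k => val (V k) x)) => k t; exact: VP.
  by exists T.
(* The occupied slots start at 1: [r00] keeps them in place, [r10] moves every slot one up and so
   vacates slot 1, and [r01] moves them one down and discards the content of slot 1. *)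
pose r00 m := if (m == 0)%N then None else Some m.
pose r10 m := if (m <= 1)%N then None else Some m.-1.
pose r01 m := if (m == 0)%N then None else Some m.+1.
have ok00 : ok r00.
  split=> // a N a0; rewrite big_ord_recr /=.
  apply: (@le_trans _ _ (\sum_(n < N) a n)); last by rewrite lerDl.
  by apply: ler_sum => n _; rewrite /r00; case: eqP.
have ok10 : ok r10.
  split=> // a [|N] a0; first by rewrite big_ord0 sumr_ge0.
  rewrite big_ord_recl add0r 2!big_ord_recr /= -addrA.
  apply: (@le_trans _ _ (\sum_(n < N) a n)); last by rewrite lerDl addr_ge0.
  by apply: ler_sum => n _; rewrite /r10; case: ifP.
have ok01 : ok r01.
  split=> // a N a0; rewrite big_ord_recl /=.
  apply: (@le_trans _ _ (\sum_(n < N) a n.+1)); last by rewrite lerDr.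
  by apply: ler_sum => n _; rewrite /r01; case: eqP.
pose Zu (g : B) x m : J := if (m == 1)%N then val (Q * g) x else 0.
have single (f : nat -> R) N : (forall n, n != 1%N -> f n = 0) -> 0 <= f 1%N ->
    \sum_(n < N) f n <= f 1%N.
  move=> f0 f1; case: N => [|[|N]]; first by rewrite big_ord0.
    by rewrite big_ord1 f0.
  rewrite 2!big_ord_recl f0// add0r big1 ?addr0// => n _; exact: f0.
have first (g : B) : exists T : B, forall x t, val (val T x) t = join_blocks s co (Zu g x) t.
  have [m m0 gm] := g0 g.
  apply: (exists_join_blocks co_le coK hK co_lt m0) => //.
  - move=> b x y n t; rewrite /Zu; case: eqP => _; last by rewrite valJ0 mulr0 addr0.
    by rewrite op_linear valJD valJZ.
  - by move=> x n a sa; rewrite /Zu; case: eqP => // _; exact: Qs.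
  - move=> x N; apply: le_trans (gm x).
    have Z0 n : n != 1%N -> nrm (Zu g x n) `^ p = 0.
      by rewrite /Zu => /negbTE ->; rewrite nrm0 powR0 ?gt_eqF.
    have Z1 : Zu g x 1%N = val (Q * g) x by rewrite /Zu eqxx.
    by rewrite -Z1; exact: (single (fun n => nrm (Zu g x n) `^ p) N Z0 (powR_ge0 _ _)).
have [u uP] := choice first.
have [f00 /(_ _ ok00) f00P] := choice (shift r00).
have [f10 /(_ _ ok10) f10P] := choice (shift r10).
have [f01 /(_ _ ok01) f01P] := choice (shift r01).
have V_join (z : nat -> J) x k : (forall n a, club s a -> val (z n) a = 0) ->
    (forall t, val x t = join_blocks s co z t) -> val (V k) x = z k.
  move=> zs xz; apply: val_inj; apply/funext => t; rewrite VP /unblock !xz.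
  by rewrite !(join_blocks_emb s hK) (zs k (c t)) ?subr0//; exact: club_nextP.
have Zs r g x n a : club s a -> val (Z r g x n) a = 0.
  by move=> sa; rewrite /Z; case: (r n) => // k; exact: Qs.
have Zus g x n a : club s a -> val (Zu g x n) a = 0.
  by move=> sa; rewrite /Zu; case: eqP => // _; exact: Qs.
have join_ext (z z' : nat -> J) t : (forall n, z n = z' n) -> join_blocks s co z t = join_blocks s co z' t.
  by move=> zz; congr (join_blocks _ _ _ _); apply/funext.
have join_blocksD (z z' z'' : nat -> J) w : (forall n, z n + z' n = z'' n) ->
    join_blocks s co z w + join_blocks s co z' w = join_blocks s co z'' w.
  move=> zz; rewrite /join_blocks /layer eqxx /=; case: ifP => _; last by rewrite addr0.
  by rewrite -zz.
have ZS r g x n k : r n = Some k -> Z r g x n = val (Q * g) (val (V k) x).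
  by rewrite /Z => ->.
have ZN r g x n : r n = None -> Z r g x n = 0 by rewrite /Z => ->.
have ZZ r1 r2 g h' T x n k l : r1 n = Some k -> r2 k = Some l -> Q * h' = h' ->
    (forall t, val (val T x) t = join_blocks s co (Z r2 h' x) t) ->
    Z r1 g (val T x) n = val (Q * (g * h')) (val (V l) x).
  move=> r1k r2l Qh TP; rewrite (ZS _ _ _ _ _ r1k) (V_join (Z r2 h' x)) //; last exact: Zs.
  by rewrite (ZS _ _ _ _ _ r2l) Qh mulrA [RHS]op_mulE.
exists (V 1%N), u, f00, f10, f01; split.
- move=> g h'; apply: bounded_op_ext => x t; rewrite op_addE valJD !f00P; apply/esym/join_blocksD => n.
  case: n => [|n]; first by rewrite !ZN// addr0.
  by rewrite !(ZS r00 _ x n.+1 n.+1 erefl) mulrDr op_addE.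
- move=> g h' Qh; apply: bounded_op_ext => x t; rewrite op_addE valJD !op_mulE uP f10P f00P.
  apply: join_blocksD => -[|[|n]].
  + by rewrite /Zu /= !ZN// addr0.
  + by rewrite /Zu eqxx ZN// addr0 (ZS r00 _ x 1%N 1%N erefl) mulrA [RHS]op_mulE op_mulE.
  + rewrite /Zu /= add0r (ZZ r10 r01 g h' (f01 h') x n.+2 n.+1 n.+2 erefl erefl Qh (f01P _ _)).
    by rewrite (ZS r00 _ x n.+2 n.+2 erefl).
- move=> g h' Qh; split; apply: bounded_op_ext => x t; rewrite op_mulE ?f01P !f00P; apply: join_ext => -[|n].
  + by rewrite !ZN.
  + rewrite (ZZ r00 r00 g h' (f00 h') x n.+1 n.+1 n.+1 erefl erefl Qh (f00P _ _)).
    by rewrite (ZS r00 _ x n.+1 n.+1 erefl).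
  + by rewrite !ZN.
  + rewrite (ZZ r01 r10 g h' (f10 h') x n.+1 n.+2 n.+1 erefl erefl Qh (f10P _ _)).
    by rewrite (ZS r00 _ x n.+1 n.+1 erefl).
- move=> g; apply: bounded_op_ext => x t; rewrite op_mulE (V_join (Zu g x)); [|exact: Zus|exact: uP].
  by rewrite /Zu eqxx.
- move=> g h'; split; apply: bounded_op_ext => x t; rewrite op_mulE.
    by rewrite (V_join (Z r10 g x)); [rewrite ZN|exact: Zs|exact: f10P].
  rewrite f01P.
  have -> : val (val (0 : B) x) t = join_blocks s co (fun=> 0 : J) t.
    by rewrite /join_blocks /layer; case: ifP.
  apply: join_ext => -[|n]; first by rewrite ZN.
  rewrite (ZS r01 _ _ n.+1 n.+2 erefl) (V_join (Zu h' x)); [|exact: Zus|exact: uP].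
  by have -> : Zu h' x n.+2 = 0 by []; exact: op0.
Qed.

End Swindle.

Lemma exists_corner n (e : 'M[B]_n) : exists E : B,
  [/\ E * E = E, forall l, E * scalar_op l = scalar_op l * E,
      forall i j, E * e i j = scalar_op (character (e i j)) * E & swindle (1 - E)].
Proof.
have [s' s'P] := choice (fun ij : 'I_n * 'I_n => characterP (e ij.1 ij.2)).
(* A pointwise bound of the functions of all entries defines a club contained in each of theirs. *)
have [s sP] := choice (fun b => omega1_seq_ub hW (fun ij => s' ij b)).
have ss' ij a : club s a -> club (s' ij) a.
  by case=> a0 sa; split=> // b ba; apply: lt_trans (sP b ij) (sa b ba).
have [E EP] := exists_next p1 hW s.
exists E; split; last exact: swindle_next EP.
- apply: bounded_op_ext => x t; rewrite op_mulE !EP club_next_id//; exact: club_nextP.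
- by move=> l; apply: bounded_op_ext => x t; rewrite !op_mulE !scalar_opE EP !valJZ EP.
- move=> i j; apply: bounded_op_ext => x t; rewrite !op_mulE scalar_opE EP valJZ EP.
  by apply: (s'P (i, j)); apply: ss'; exact: club_nextP.
Qed.

End Character.

Theorem proposition3p13 (R : realType) (p : R) (p1 : 1 < p)
    (d : Order.disp_t) (W : orderTopologicalType d) (hW : is_omega1 W) :
  exists f : {additive K0 (bounded_op (james p1 hW)) -> int}, bijective f.
Proof.
pose lam : {rmorphism bounded_op (james p1 hW) -> R[i]} := @character _ _ p1 _ _ hW.
pose iota : {rmorphism R[i] -> bounded_op (james p1 hW)} := @scalar_op _ _ p1 _ _ hW.
exact: (@K0_int _ _ lam iota (@exists_corner _ _ p1 _ _ hW)).
Qed.
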